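(* Let $V$ and $V'$ be left vector spaces over fields $K$ and $K'$ respectively, with $\mathcal G'\neq\emptyset$, where $\dim V=2m$ is finite. A bijection $\phi:\mathcal G\to\mathcal G'$ is an isomorphism of distant graphs (i.e. $X\oplus Y=V\iff X^\phi\oplus Y^\phi=V'$ for all $X,Y\in\mathcal G$) if and only if one of the following holds: (a) $\dim V=\dim V'=0$; (b) $\dim V=\dim V'=2$ and $K$ and $K'$ have the same cardinality; (c) $4\le\dim V=\dim V'=2m<\infty$ and either there is a semilinear bijection $f:V\to V'$ with $X^\phi=X^f$ for all $X\in\mathcal G$, or there is a semilinear bijection $f:V^*\to V'$ (with respect to an antiisomorphism $K\to K'$) with $X^\phi=(X^\perp)^f$ for all $X\in\mathcal G$.
   Context: Fields are not necessarily commutative (division rings). For a left vector space $V$ over $K$, $\mathcal G$ denotes the set of all subspaces $X\le V$ such that $X$ is isomorphic to $V/X$ (for $\dim V=2m$ finite, these are exactly the $m$-dimensional subspaces); $\mathcal G'$ is defined likewise for $V'$. A semilinear bijection $f:V\to V'$ is an additive bijection with $(av)^f=a^\sigma v^f$ for some field isomorphism $\sigma:K\to K'$; $X^f$ denotes the image of $X$. $V^*$ is the dual space of $V$, regarded as a right vector space over $K$; a semilinear bijection $f:V^*\to V'$ is an additive bijection with $(\varphi a)^f=a^\sigma\varphi^f$ for some antiisomorphism $\sigma:K\to K'$. For a subspace $X\le V$, $X^\perp\le V^*$ is its annihilator $\{\varphi\in V^*:\varphi(X)=0\}$. *)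

(* Defs.v *)
From HB Require Import structures.
From mathcomp Require Import all_boot all_order all_algebra.
Set Implicit Arguments. Unset Strict Implicit. Unset Printing Implicit Defensive.
Import GRing.Theory.
Local Open Scope ring_scope.

(* A field (= division ring): every nonzero element is invertible.
   unitRingType is already a nontrivial ring (1 != 0). *)
Definition division_ring (K : unitRingType) : Prop :=
  forall x : K, x != 0 -> x \is a GRing.unit.

Definition subspace (K : unitRingType) (V : lmodType K) (X : V -> Prop) : Prop :=
  [/\ X 0, (forall x y, X x -> X y -> X (x + y)) & (forall (a : K) x, X x -> X (a *: x))].

Definition linmap (K : unitRingType) (U W : lmodType K) (f : U -> W) : Prop :=
  (forall x y, f (x + y) = f x + f y) /\ (forall (a : K) x, f (a *: x) = a *: f x).

(* X is isomorphic to V/X: there is a linear map g : V -> V with image X and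
   kernel X (first isomorphism theorem: V/ker g ~ im g). *)
Definition iso_to_quotient (K : unitRingType) (V : lmodType K) (X : V -> Prop) : Prop :=
  exists g : V -> V, [/\ linmap g, (forall v, X (g v)),
                        (forall x, X x -> exists v, g v = x) &
                        (forall v, g v = 0 <-> X v)].

Definition inG (K : unitRingType) (V : lmodType K) (X : V -> Prop) : Prop :=
  subspace X /\ iso_to_quotient X.

Definition Gset (K : unitRingType) (V : lmodType K) := {X : V -> Prop | inG X}.

Definition has_dim (K : unitRingType) (V : lmodType K) (n : nat) : Prop :=
  exists f : V -> 'rV[K]_n, linmap f /\ bijective f.

Definition direct_sum (K : unitRingType) (V : lmodType K) (X Y : V -> Prop) : Prop :=
  (forall v, X v -> Y v -> v = 0) /\
  (forall v, exists x y, [/\ X x, Y y & v = x + y]).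

Definition distant_iso (K K' : unitRingType) (V : lmodType K) (V' : lmodType K')
  (phi : Gset V -> Gset V') : Prop :=
  forall X Y : Gset V,
    direct_sum (sval X) (sval Y) <-> direct_sum (sval (phi X)) (sval (phi Y)).

Definition ring_iso (K K' : unitRingType) (s : K -> K') : Prop :=
  [/\ bijective s, (forall a b, s (a + b) = s a + s b) & (forall a b, s (a * b) = s a * s b)].
Definition ring_antiiso (K K' : unitRingType) (s : K -> K') : Prop :=
  [/\ bijective s, (forall a b, s (a + b) = s a + s b) & (forall a b, s (a * b) = s b * s a)].

Definition semilinear_bij (K K' : unitRingType) (V : lmodType K) (V' : lmodType K')
  (s : K -> K') (f : V -> V') : Prop :=
  [/\ bijective f, (forall x y, f (x + y) = f x + f y) &
      (forall (a : K) v, f (a *: v) = s a *: f v)].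

(* Dual space V^* : linear functionals V -> K (K as left module over itself),
   a right vector space via (phi a)(v) = phi(v) a. *)
Definition functional (K : unitRingType) (V : lmodType K) (p : V -> K) : Prop :=
  (forall x y, p (x + y) = p x + p y) /\ (forall (a : K) x, p (a *: x) = a * p x).

Definition dual_semilinear_bij (K K' : unitRingType) (V : lmodType K) (V' : lmodType K')
  (s : K -> K') (f : (V -> K) -> V') : Prop :=
  [/\ (forall p q, functional p -> functional q -> f p = f q -> p = q),
      (forall y, exists p, functional p /\ f p = y),
      (forall p q, functional p -> functional q -> f (fun v => p v + q v) = f p + f q) &
      (forall p (a : K), functional p -> f (fun v => p v * a) = s a *: f p)].

(* Main.v *)
(* Adjacency (dim X/(X n Y) = dim Y/(X n Y) = 1) is visible in the distant graph: distinct
   X, Y, R belong to a common pencil iff every complement of one of them is a complement of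
   one of the other two.  Paths of adjacent subspaces bound dimensions, so V' is
   2m-dimensional too, and phi preserves adjacency and pencils in both directions (Chow).
   A triangle of the adjacency graph outside a pencil either shares a hyperplane ("star") or
   spans an (m+1)-space ("top"); whether phi keeps or exchanges the two kinds is the same for
   all adjacent pairs, by connectedness.  If it keeps them, A |-> intersection of the phi(X),
   X >= A, preserves dimensions (downward induction from m), hence is a collineation, and the
   fundamental theorem of projective geometry applies.  If it exchanges them, precompose
   with the annihilator map of the dual space. *)
Require Import Defs.
From HB Require Import structures.
From mathcomp Require Import all_boot all_order all_algebra.
From mathcomp Require Import boolp classical_sets zify.
Set Implicit Arguments. Unset Strict Implicit. Unset Printing Implicit Defensive.
Import GRing.Theory.
Local Open Scope ring_scope.

(** * Subspaces and dimension *)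

Section Subspaces.
Variables (K : unitRingType) (V : lmodType K).

(** At first nothing is known about V', not even that its dimension is finite. So dimension is the
    length of a chain of covers, complements come from Zorn's lemma, and pencils are recovered in
    arbitrary dimension; only then do path lengths bound the dimension of V'. Recovery works by
    testing with a complement of R forced through one or two chosen vectors. Kinds are compared
    through third vertices: two triangles on a common edge have the same kind exactly when their
    third vertices are equal or adjacent, so a single triangle decides for its edge. The condition
    2m >= 4 enters three times: an (m+1)-space is proper, so stars exist; points and lines of the
    projective space have dimension at most m, where the intersection map is controlled; and any
    three vectors leave room for a fourth, which does the work of Desargues' theorem. In dimension
    2, distant merely means distinct. The dual is modelled by rows over the opposite ring [K^c]. The
    second alternative of (c) is then the first one for a space over [K^c], and a ring isomorphism
    out of [K^c] is an antiisomorphism out of [K]. *)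

Record sub := Sub { carrier :> V -> Prop; carrierP : subspace carrier }.

Implicit Types (A B C X : sub).

Definition les A B : Prop := forall v, A v -> B v.

Lemma sub_ext A B : les A B -> les B A -> A = B.
Proof.
case: A B => [A sA] [B sB] lAB lBA; have eAB : A = B.
  by apply/funext => v; apply/propext; split; [apply: lAB | apply: lBA].
by subst B; congr Sub; apply: Prop_irrelevance.
Qed.

Lemma sub0 A : A 0. Proof. by case: (carrierP A). Qed.
Lemma subD A x y : A x -> A y -> A (x + y).
Proof. by case: (carrierP A) => _ h _; apply: h. Qed.
Lemma subZ A a x : A x -> A (a *: x).
Proof. by case: (carrierP A) => _ _ h; apply: h. Qed.
Lemma subN A x : A x -> A (- x).
Proof. by rewrite -scaleN1r; apply: subZ. Qed.
Lemma subB A x y : A x -> A y -> A (x - y).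
Proof. by move=> Ax Ay; apply: subD => //; apply: subN. Qed.

Lemma zero_subspace : subspace (fun v : V => v = 0).
Proof. by split=> // [x y -> ->|a x ->]; rewrite ?addr0 ?scaler0. Qed.
Definition zeros := Sub zero_subspace.

Lemma full_subspace : subspace (fun _ : V => True). Proof. by []. Qed.
Definition fulls := Sub full_subspace.

Lemma cap_subspace A B : subspace (fun v => A v /\ B v).
Proof.
split=> [|x y [Ax Bx] [Ay By]|a x [Ax Bx]]; first by split; apply: sub0.
  by split; apply: subD.
by split; apply: subZ.
Qed.
Definition caps A B := Sub (cap_subspace A B).

Lemma bigcap_subspace (P : sub -> Prop) : subspace (fun v => forall A, P A -> A v).
Proof.
split=> [A _|x y hx hy A PA|a x hx A PA]; first exact: sub0.
  by apply: subD; [apply: hx | apply: hy].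
by apply: subZ; apply: hx.
Qed.
Definition bigcaps P := Sub (bigcap_subspace P).

Lemma sum_subspace A B : subspace (fun v => exists x y, [/\ A x, B y & v = x + y]).
Proof.
split=> [|_ _ [x [y [Ax By ->]]] [x' [y' [Ax' By' ->]]]|a _ [x [y [Ax By ->]]]].
- by exists 0, 0; split; rewrite ?addr0 //; apply: sub0.
- by exists (x + x'), (y + y'); split; [apply: subD..|rewrite addrACA].
- by exists (a *: x), (a *: y); split; [apply: subZ..|rewrite scalerDr].
Qed.
Definition sums A B := Sub (sum_subspace A B).

Lemma line_subspace (v : V) : subspace (fun x => exists a : K, x = a *: v).
Proof.
split=> [|_ _ [a ->] [b ->]|b _ [a ->]].
- by exists 0; rewrite scale0r.
- by exists (a + b); rewrite scalerDl.
- by exists (b * a); rewrite scalerA.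
Qed.
Definition lines v := Sub (line_subspace v).

Definition exts A v := sums A (lines v).

Lemma les_refl A : les A A. Proof. by []. Qed.
Lemma les_trans B A C : les A B -> les B C -> les A C.
Proof. by move=> h1 h2 v /h1/h2. Qed.
Lemma les0 A : les zeros A. Proof. by move=> v ->; apply: sub0. Qed.
Lemma lesT A : les A fulls. Proof. by []. Qed.
Lemma capl A B : les (caps A B) A. Proof. by move=> v []. Qed.
Lemma capr A B : les (caps A B) B. Proof. by move=> v []. Qed.
Lemma les_cap A B C : les C A -> les C B -> les C (caps A B).
Proof. by move=> h1 h2 v Cv; split; [apply: h1|apply: h2]. Qed.
Lemma suml A B : les A (sums A B).
Proof. by move=> v Av; exists v, 0; split; rewrite ?addr0 //; apply: sub0. Qed.
Lemma sumr A B : les B (sums A B).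
Proof. by move=> v Av; exists 0, v; split; rewrite ?add0r //; apply: sub0. Qed.
Lemma sum_les A B C : les A C -> les B C -> les (sums A B) C.
Proof. by move=> h1 h2 _ [x [y [/h1 Ax /h2 By ->]]]; apply: subD. Qed.
Lemma sumC A B : sums A B = sums B A.
Proof. by apply: sub_ext; apply: sum_les; (apply: suml || apply: sumr). Qed.
Lemma capC A B : caps A B = caps B A.
Proof. by apply: sub_ext => v []. Qed.
Lemma line_self v : lines v v. Proof. by exists 1; rewrite scale1r. Qed.
Lemma line_les v A : A v -> les (lines v) A.
Proof. by move=> Av _ [a ->]; apply: subZ. Qed.
Lemma ext_self A v : exts A v v. Proof. by apply: sumr; apply: line_self. Qed.
Lemma ext_les A v : les A (exts A v). Proof. exact: suml. Qed.
Lemma ext_leP A v B : les A B -> B v -> les (exts A v) B.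
Proof. by move=> lAB Bv; apply: sum_les => //; apply: line_les. Qed.
Lemma extP A v x : exts A v x -> exists a y, A y /\ x = y + a *: v.
Proof. by case=> y [_ [Ay [a ->] ->]]; exists a, y. Qed.
Lemma capE A B : les A B -> caps A B = A.
Proof. by move=> lAB; apply: sub_ext => [v []//|v Av]; split=> //; apply: lAB. Qed.
Lemma sumE A B : les A B -> sums A B = B.
Proof. by move=> lAB; apply: sub_ext; [apply: sum_les|apply: sumr]. Qed.

Lemma not_les A B : ~ les A B -> exists v, A v /\ ~ B v.
Proof. by move=> /existsNP[v /not_implyP h]; exists v. Qed.

Lemma neq_sub A B : les A B -> A <> B -> exists v, B v /\ ~ A v.
Proof. by move=> lAB nAB; apply: not_les => lBA; apply: nAB; apply: sub_ext. Qed.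

(* [B] covers [A] in the lattice of subspaces, i.e. [dim B/A = 1] *)
Definition cov A B := exists v, ~ A v /\ B = exts A v.

Lemma cov_les A B : cov A B -> les A B.
Proof. by case=> v [_ ->]; apply: ext_les. Qed.
Lemma cov_neq A B : cov A B -> A <> B.
Proof. by case=> v [nAv ->] e; apply: nAv; rewrite e; apply: ext_self. Qed.
Lemma cov_ext A v : ~ A v -> cov A (exts A v). Proof. by exists v. Qed.

Hypothesis hK : division_ring K.

Lemma unscale (a : K) (x : V) : a != 0 -> a^-1 *: (a *: x) = x.
Proof. by move=> /hK ua; rewrite scalerA mulVr // scale1r. Qed.

Lemma subZ_inv A a x : a != 0 -> A (a *: x) -> A x.
Proof. by move=> a0 h; rewrite -(unscale x a0); apply: subZ. Qed.

Lemma scale_eq0 (a : K) (x : V) : a *: x = 0 -> x <> 0 -> a = 0.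
Proof.
move=> e nx; apply: contrapT => /eqP a0; apply: nx.
by rewrite -(unscale x a0) e scaler0.
Qed.

Lemma ext_exchange A v w : exts A v w -> ~ A w -> exts A w = exts A v.
Proof.
move=> /[dup] ew /extP[a [y [Ay e]]] nAw; apply: sub_ext; apply: ext_leP => //; try exact: ext_les.
have a0 : a != 0.
  by apply/eqP => a0; apply: nAw; rewrite e a0 scale0r addr0.
apply: (subZ_inv a0); have -> : a *: v = w - y by rewrite e addrAC subrr add0r.
by apply: subB; [apply: ext_self|apply: ext_les].
Qed.

Lemma cov_extE A B w : cov A B -> B w -> ~ A w -> B = exts A w.
Proof. by case=> v [_ ->] Bw nAw; rewrite (ext_exchange Bw nAw). Qed.

Lemma cov_between A B C : cov A B -> les A C -> les C B -> C = A \/ C = B.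
Proof.
move=> cAB lAC lCB; have [lCA|/not_les[w [Cw nAw]]] := pselect (les C A).
  by left; apply: sub_ext.
right; apply: sub_ext => //; rewrite (cov_extE cAB (lCB _ Cw) nAw).
exact: ext_leP.
Qed.

Lemma ext_cap A w X : X w -> caps (exts A w) X = exts (caps A X) w.
Proof.
move=> Xw; apply: sub_ext.
  move=> x [/extP[a [y [Ay ->]]] Xx]; exists y, (a *: w); split=> //; last by exists a.
  split=> //; have -> : y = (y + a *: w) - a *: w by rewrite addrK.
  by apply: subB => //; apply: subZ.
apply: ext_leP; last by split=> //; apply: ext_self.
by move=> x [Ax Xx]; split=> //; apply: ext_les.
Qed.

Lemma sum_ext A v X : sums (exts A v) X = exts (sums A X) v.
Proof.
apply: sub_ext.
  apply: sum_les; last by apply: (les_trans (@sumr _ _)); apply: ext_les.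
  apply: ext_leP; last exact: ext_self.
  by apply: (les_trans (@suml _ _)); apply: ext_les.
apply: ext_leP; last by apply: suml; apply: ext_self.
by apply: sum_les; [apply: (les_trans (@ext_les _ _)); apply: suml|apply: sumr].
Qed.

(* Meeting, resp. joining, with [X] collapses a covering pair in exactly one of the two cases. *)
Lemma cov_modular A B X : cov A B ->
  (cov (caps A X) (caps B X) /\ sums A X = sums B X) \/
  (caps A X = caps B X /\ cov (sums A X) (sums B X)).
Proof.
move=> cAB; have [[w [[Bw Xw] nAw]]|h] := pselect (exists w, (B w /\ X w) /\ ~ A w).
  left; rewrite (cov_extE cAB Bw nAw) ext_cap // sum_ext; split.
    by apply: cov_ext => -[].
  apply: sub_ext; first exact: ext_les.
  by apply: ext_leP => //; apply: sumr.
have lcap : les (caps B X) (caps A X).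
  move=> x [Bx Xx]; split=> //; apply: contrapT => nAx; apply: h.
  by exists x.
right; split.
  by apply: sub_ext => // x [Ax Xx]; split=> //; apply: cov_les Ax.
have [v [nAv eB]] := cAB; rewrite eB sum_ext; apply: cov_ext.
move=> [a [x [Aa Xx e]]]; apply: nAv; rewrite e; apply: subD => //.
have -> : x = v - a by rewrite e addrAC subrr add0r.
apply: (capl (B := X)); apply: lcap; split.
  by apply: subB; [rewrite eB; apply: ext_self|apply: (cov_les cAB)].
by have -> : v - a = x by rewrite e addrAC subrr add0r.
Qed.

(** Length of a chain of covers from 0: no basis has to be chosen, and the notion makes sense in a
    space not yet known to be finite-dimensional. *)
Fixpoint hasdim k (A : sub) : Prop :=
  if k is k'.+1 then exists B, hasdim k' B /\ cov B A else A = zeros.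

(** Meeting a chain for [A] with [C] gives a chain for [C] once repetitions are deleted. The last
    clause carries strictness through the induction; [dims_les_eq] rests on it. *)
Lemma hasdim_les k A C : hasdim k A -> les C A ->
  exists j, [/\ (j <= k)%N, hasdim j C & (C = A \/ (j < k)%N)].
Proof.
elim: k A C => [|k IH] A C /=.
  move=> -> lC; exists 0%N; have -> : C = zeros by apply: sub_ext => //; apply: les0.
  by split=> //; left.
move=> [B [dB cBA]] lCA; have [j [jk dj hj]] := IH B (caps B C) dB (capl (B := C)).
have eC : caps A C = C by rewrite capC capE.
case: (cov_modular C cBA); rewrite eC => -[h1 h2].
  exists j.+1; split=> //=; first by exists (caps B C).
  case: hj => [hj|]; last by right.
  left; have lBC : les B C by rewrite -hj; apply: capr.
  by case: (cov_between cBA lBC lCA) => // e; case: (cov_neq h1); rewrite hj e.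
exists j; rewrite -h1; split=> //; [exact: leqW|by right].
Qed.

(** A Jordan-Hölder argument: distinct hyperplanes [B] and [C] of [A] share the hyperplane
    [caps B C], of some length [j], so by induction both have length [j.+1]. *)
Lemma hasdim_inj k l A : hasdim k A -> hasdim l A -> k = l.
Proof.
elim: k l A => [|k IH] [|l] A //=.
- move=> -> [B [_ [v [nBv e]]]]; case: nBv;
  by have: zeros v; [rewrite e; apply: ext_self|move=> ->; apply: sub0].
- move=> [B [_ [v [nBv e]]]] e0; case: nBv;
  by have: zeros v; [rewrite -e0 e; apply: ext_self|move=> ->; apply: sub0].
move=> [B [dB cB]] [C [dC cC]]; congr S.
have [e|nBC] := pselect (B = C); first by apply: (IH _ B) => //; rewrite e.
have sBC : sums B C = A.
  have [||e] // := cov_between cB (@suml B C).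
    by apply: sum_les; apply: cov_les.
  move=> e'; have lCB : les C B by rewrite -e'; apply: sumr.
  by have := cov_neq cB; case: (cov_between cC lCB (cov_les cB)) => // ->.
have [j [_ dj _]] := hasdim_les dB (capl (B := C)).
have nsB : sums B C <> B by rewrite sBC => e; apply: (cov_neq cB).
have cov1 : cov (caps B C) C.
  case: (cov_modular C cB) => -[]; rewrite [caps A C]capC (capE (cov_les cC)) //.
  by rewrite sBC [sums A C]sumC (sumE (cov_les cC)) => _ /cov_neq.
have cov2 : cov (caps B C) B.
  case: (cov_modular B cC) => -[]; rewrite [caps A B]capC (capE (cov_les cB)) [caps C B]capC //.
  by rewrite [sums C B]sumC sBC [sums A B]sumC (sumE (cov_les cB)) => _ /cov_neq.
have dB' : hasdim j.+1 B by exists (caps B C).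
have dC' : hasdim j.+1 C by exists (caps B C).
by apply: (IH _ C) => //; rewrite (IH _ _ dB dB').
Qed.

(** By [cov_modular], each cover in a chain for [B] raises exactly one of the intersection and the
    sum. *)
Lemma hasdim_modular a b A B : hasdim a A -> hasdim b B ->
  exists c d, [/\ hasdim c (caps A B), hasdim d (sums A B) & (c + d = a + b)%N].
Proof.
move=> dA; elim: b B => [|b IH] B /=.
  move=> ->; exists 0%N, a; rewrite capC (capE (@les0 A)) sumC (sumE (@les0 A)).
  by split=> //; rewrite add0n addn0.
move=> [C [dC cCB]]; have [c [d [dc dd e]]] := IH C dC.
case: (cov_modular A cCB) => -[h1 h2].
  exists c.+1, d; split; last by lia.
    by exists (caps A C); split=> //; rewrite [caps A C]capC [caps A B]capC.
  by rewrite sumC -h2 sumC.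
exists c, d.+1; split; last by lia.
  by rewrite capC -h1 capC.
by exists (sums A C); split=> //; rewrite [sums A C]sumC [sums A B]sumC.
Qed.

End Subspaces.

#[local] Hint Resolve les_refl : core.

(** * Complements by Zorn's lemma, and separating functionals *)

Section Complements.
Variables (K : unitRingType) (V : lmodType K).
Hypothesis hK : division_ring K.
Implicit Types (A B C R W X Y Z : sub V).

Lemma direct_sumC X Y : direct_sum X Y -> direct_sum Y X.
Proof.
move=> [h1 h2]; split=> [v Yv Xv|v]; first exact: h1.
by have [x [y [Xx Yy ->]]] := h2 v; exists y, x; rewrite addrC.
Qed.

(** Zorn's lemma rather than a dimension count, since complements are needed in [V'] before that
    space is known to be finite-dimensional. *)
Lemma complement_above W R : (forall v, W v -> R v -> v = 0) ->
  exists Z, les W Z /\ direct_sum Z R.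
Proof.
move=> hWR.
pose good (Z : sub V) := les W Z /\ forall v, Z v -> R v -> v = 0.
(* The union of the empty chain has to satisfy the predicate, hence the disjunct [X = set0]; it
   cannot be maximal, because [W] is larger. *)
pose P (X : set V) := X = set0 \/ exists Z, good Z /\ X = Z :> set V.
have [F FP Ftot|A [[A0|[Z [[lWZ hZR] eA]]] maxA]] := @Zorn_bigcup V P.
- have [[X0 [FX0 [w X0w]]]|h] := pselect (exists X : set V, F X /\ exists w, X w); last first.
    by left; apply/seteqP; split=> // x [X FX Xx]; case: h; exists X; split=> //; exists x.
  right; pose U (v : V) := exists X : set V, F X /\ X v.
  have inF (X : set V) x : F X -> X x -> exists Z, good Z /\ X = Z :> set V.
    by move=> FX Xx; case: (FP X FX) => // X0'; rewrite X0' in Xx.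
  have [Z0 [[lWZ0 _] eX0]] := inF _ _ FX0 X0w.
  have sU : subspace U.
    split=> [|x y [X [FX Xx]] [Y [FY Yy]]|a x [X [FX Xx]]].
    - by exists X0; split=> //; rewrite eX0; apply: sub0.
    - case: (Ftot X Y FX FY) => lXY.
        exists Y; split=> //; have [Z [_ eY]] := inF _ _ FY Yy.
        by move: (lXY x Xx) Yy; rewrite eY; apply: subD.
      exists X; split=> //; have [Z [_ eX]] := inF _ _ FX Xx.
      by move: Xx (lXY y Yy); rewrite eX; apply: subD.
    - exists X; split=> //; have [Z [_ eX]] := inF _ _ FX Xx.
      by move: Xx; rewrite eX; apply: subZ.
  exists (Sub sU); split.
    split=> [v Wv|v [X [FX Xv]] Rv]; first by exists X0; split=> //; rewrite eX0; apply: lWZ0.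
    have [Z [[_ h] eX]] := inF _ _ FX Xv.
    by apply: h => //; rewrite -eX.
  by apply/seteqP; split=> v [X]; [move=> FX Xv|case=> FX Xv]; exists X.
- have PW : P W by right; exists W; split=> //; split.
  case: (maxA W _ PW); rewrite A0; split=> // /(_ 0 (sub0 W)).
  by [].
exists Z; split=> //; split=> // v; apply: contrapT => nv.
have nZv : ~ Z v.
  by move=> Zv; apply: nv; exists v, 0; split; rewrite ?addr0 //; apply: sub0.
suff PZv : P (exts Z v).
  case: (maxA (exts Z v) _ PZv); rewrite eA; split; first exact: ext_les.
  by move=> /(_ v (ext_self Z v)).
right; exists (exts Z v); split=> //; split; first by move=> x /lWZ; apply: ext_les.
move=> x /extP[a [y [Zy ex]]] Rx; have [a0|a0] := eqVneq a 0.
  by apply: hZR => //; rewrite ex a0 scale0r addr0.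
case: nv; exists (a^-1 *: - y), (a^-1 *: x); split; [by apply/subZ/subN|exact: subZ|].
by rewrite -scalerDr ex addKr unscale.
Qed.

Lemma not_line W v w : ~ W v -> W w -> lines v w -> w = 0.
Proof.
move=> nWv Ww [a e]; have [a0|a0] := eqVneq a 0; first by rewrite e a0 scale0r.
by case: nWv; apply: (subZ_inv hK a0); rewrite -e.
Qed.

(** The functional reads off the coordinate along [v] with respect to a complement of [lines v] that
    contains [W]. *)
Lemma functional_sep W v : ~ W v ->
  exists p, [/\ functional p, (forall w, W w -> p w = 0) & p v = 1].
Proof.
move=> nWv; have [w Ww Lw|Z [lWZ [hZ1 hZ2]]] := @complement_above W (lines v).
  exact: (not_line nWv Ww Lw).
have nZv : ~ Z v.
  move=> Zv; apply: nWv; rewrite (hZ1 v Zv (line_self v)); exact: sub0.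
have ex x : exists a : K, Z (x - a *: v).
  by have [z [_ [Zz [a ->] ->]]] := hZ2 x; exists a; rewrite addrK.
have [p hp] := choice ex.
have uniq x a : Z (x - a *: v) -> p x = a.
  move=> h; apply: contrapT => /eqP; rewrite -subr_eq0 => ne.
  apply: nZv; apply: (subZ_inv hK ne); rewrite scalerBl.
  have -> : p x *: v - a *: v = (x - a *: v) - (x - p x *: v).
    by rewrite opprB [RHS]addrC addrA subrK.
  exact: subB.
exists p; split.
- split=> [x y|a x]; apply: uniq.
    by rewrite scalerDl opprD addrACA; apply: subD.
  by rewrite -scalerA -scalerBr; apply: subZ.
- by move=> w /lWZ Zw; apply: uniq; rewrite scale0r subr0.
- by apply: uniq; rewrite scale1r subrr; apply: sub0.
Qed.

End Complements.

(** * The dimension function of a finite-dimensional space *)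

Section Dimension.
Variables (K : unitRingType) (V : lmodType K).
Hypothesis hK : division_ring K.
Implicit Types (A B C R W X Y Z : sub V).

Definition findim A := exists k, hasdim k A.

(* Junk value 0 on infinite-dimensional subspaces. *)
Definition dims A : nat :=
  if pselect (findim A) is left h then projT1 (cid h) else 0%N.

Lemma dims_eq k A : hasdim k A -> dims A = k.
Proof.
move=> dA; rewrite /dims; case: pselect => [h|[]]; last by exists k.
by case: cid => l /= dl; apply: (hasdim_inj hK dl dA).
Qed.

Lemma findim_les A B : findim B -> les A B -> findim A.
Proof. by move=> [k dB] lAB; have [j [_ dj _]] := hasdim_les hK dB lAB; exists j. Qed.

Hypothesis hfin : findim (fulls V).

Lemma dimsP A : hasdim (dims A) A.
Proof. by have [k dA] := findim_les hfin (@lesT _ _ A); rewrite (dims_eq dA). Qed.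

Lemma dims_les A B : les A B -> (dims A <= dims B)%N.
Proof.
by move=> lAB; have [j [le dj _]] := hasdim_les hK (dimsP B) lAB; rewrite (dims_eq dj).
Qed.

Lemma dims_les_eq A B : les A B -> (dims B <= dims A)%N -> A = B.
Proof.
move=> lAB; have [j [_ dj [//|]]] := hasdim_les hK (dimsP B) lAB.
by rewrite (dims_eq dj) => h1 h2; lia.
Qed.

Lemma dims_sum_cap A B : (dims (caps A B) + dims (sums A B) = dims A + dims B)%N.
Proof.
have [c [d [dc dd e]]] := hasdim_modular hK (dimsP A) (dimsP B).
by rewrite (dims_eq dc) (dims_eq dd).
Qed.

Lemma dims0 : dims (zeros V) = 0%N. Proof. exact: dims_eq. Qed.

Lemma dims_eq0 A : dims A = 0%N -> A = zeros V.
Proof. by move=> e; have := dimsP A; rewrite e. Qed.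

Lemma dims_cov A B : cov A B -> dims B = (dims A).+1.
Proof. by move=> c; apply: dims_eq; exists A; split=> //; apply: dimsP. Qed.

Lemma dims_ext A v : ~ A v -> dims (exts A v) = (dims A).+1.
Proof. by move=> /cov_ext/dims_cov. Qed.

Lemma dims_ext_le A v : (dims (exts A v) <= (dims A).+1)%N.
Proof.
have [Av|nAv] := pselect (A v); last by rewrite dims_ext.
by apply: leqW; apply: dims_les; apply: ext_leP.
Qed.

Lemma ext0 v : exts (zeros V) v = lines v.
Proof. exact: sumE (@les0 _ _ _). Qed.

Lemma dims_line v : v <> 0 -> dims (lines v) = 1%N.
Proof. by move=> v0; rewrite -ext0 dims_ext ?dims0. Qed.

Lemma dims_line_le v : (dims (lines v) <= 1)%N.
Proof. by rewrite -ext0 (leq_trans (dims_ext_le _ _)) ?dims0. Qed.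

Lemma dims1_line A : dims A = 1%N -> exists v, v <> 0 /\ A = lines v.
Proof.
move=> e; have := dimsP A; rewrite e /= => -[B [-> [v [nv ->]]]].
by exists v; rewrite ext0.
Qed.

Lemma cov_dims A B : les A B -> dims B = (dims A).+1 -> cov A B.
Proof.
move=> lAB e; have nAB : A <> B by move=> eAB; move: e; rewrite eAB; lia.
have [v [Bv nAv]] := neq_sub lAB nAB; exists v; split=> //; symmetry.
by apply: dims_les_eq; rewrite ?dims_ext ?e //; apply: ext_leP.
Qed.

Lemma dims_outside A B : (dims A < dims B)%N -> exists v, B v /\ ~ A v.
Proof. by move=> lt; apply: not_les => /dims_les; lia. Qed.

Lemma interpolate A B k : les A B -> (dims A <= k)%N -> (k <= dims B)%N ->
  exists C, [/\ les A C, les C B & dims C = k].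
Proof.
move=> lAB; elim: k => [|k IH] leAk lekB.
  by exists A; split=> //; lia.
have [e|lt] := eqVneq (dims A) k.+1; first by exists A.
have le' : (dims A <= k)%N by lia.
have [C [lAC lCB eC]] := IH le' (ltnW lekB).
have [v [Bv nCv]] : exists v, B v /\ ~ C v by apply: dims_outside; lia.
exists (exts C v); split; [exact: les_trans lAC (@ext_les _ _ C v)|exact: ext_leP|].
by rewrite dims_ext // eC.
Qed.

Lemma direct_sum_dims X Y : direct_sum X Y -> (dims X + dims Y = dims (fulls V))%N.
Proof.
move=> [h1 h2]; rewrite -dims_sum_cap.
have -> : caps X Y = zeros V by apply: sub_ext => [v [Xv Yv]|]; [apply: h1|apply: les0].
have -> : sums X Y = fulls V by apply: sub_ext => // v _; apply: h2.
by rewrite dims0.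
Qed.

Lemma direct_sum_cap X Y : (dims X + dims Y = dims (fulls V))%N ->
  caps X Y = zeros V -> direct_sum X Y.
Proof.
move=> e h; have := dims_sum_cap X Y; rewrite h dims0 add0n e => e'.
split=> [v Xv Yv|v].
  by have: caps X Y v by []; rewrite h.
have: fulls V v by [].
by rewrite -(@dims_les_eq (sums X Y) (fulls V)) ?e'.
Qed.

Lemma direct_sum_sum X Y : (dims X + dims Y = dims (fulls V))%N ->
  sums X Y = fulls V -> direct_sum X Y.
Proof.
move=> e h; apply: direct_sum_cap => //; apply: dims_eq0.
by have := dims_sum_cap X Y; rewrite h; lia.
Qed.

End Dimension.

(** * Adjacency and pencils *)

Section Adjacency.
Variables (K : unitRingType) (V : lmodType K).
Implicit Types (A B C R W X Y Z : sub V).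

Lemma linmap0 (U W : lmodType K) (g : U -> W) : linmap g -> g 0 = 0.
Proof. by case=> _ hZ; rewrite -(scale0r 0) hZ !scale0r. Qed.

Lemma linmapN (U W : lmodType K) (g : U -> W) x : linmap g -> g (- x) = - g x.
Proof. by case=> _ hZ; rewrite -scaleN1r hZ scaleN1r. Qed.

Lemma linmapB (U W : lmodType K) (g : U -> W) x y : linmap g -> g (x - y) = g x - g y.
Proof. by move=> hg; case: (hg) => hD _; rewrite hD linmapN. Qed.

(** The kernel [X] of [g] is complementary to [Z], so [g] restricts to an isomorphism from [Z] onto
    [X]. The map for [Z] projects onto [X] along [Z] and then inverts this isomorphism. *)
Lemma inG_compl X Z : inG X -> direct_sum Z X -> inG Z.
Proof.
move=> [_ [g [lg gX Xg kg]]] [hZ1 hZ2]; split; first exact: carrierP.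
have ex v : exists z, Z z /\ Z (v - g z).
  have [z0 [x [Zz0 Xx ->]]] := hZ2 v; have [u eu] := Xg x Xx.
  have [z1 [x1 [Zz1 Xx1 e1]]] := hZ2 u; exists z1; split=> //.
  have /kg e0 := Xx1.
  have -> : g z1 = x by rewrite -eu e1 lg.1 e0 addr0.
  by rewrite addrK.
have uniq v z z' : Z z -> Z (v - g z) -> Z z' -> Z (v - g z') -> z = z'.
  move=> Zz h Zz' h'; apply/eqP; rewrite -subr_eq0; apply/eqP.
  apply: (hZ1); first exact: subB.
  apply/kg; apply: (hZ1); last exact: gX.
  rewrite linmapB //; have -> : g z - g z' = (v - g z') - (v - g z).
    by rewrite opprB [RHS]addrC addrA subrK.
  exact: subB.
have [h hh] := choice ex; exists h.
have hu v z : Z z -> Z (v - g z) -> h v = z.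
  by move=> *; apply: (@uniq v) => //; apply (hh v).
split.
- split=> [x y|a x]; apply: hu.
  + by apply: subD; apply (hh _).
  + by rewrite lg.1 opprD addrACA; apply: subD; apply (hh _).
  + by apply: subZ; apply (hh _).
  + by rewrite lg.2 -scalerBr; apply: subZ; apply (hh _).
- by move=> v; apply (hh v).
- by move=> z Zz; exists (g z); apply: hu; rewrite ?subrr //; apply: sub0.
- move=> v; split=> [e|Zv]; first by have [_] := hh v; rewrite e (linmap0 lg) subr0.
  by apply: hu; [apply: sub0|rewrite (linmap0 lg) subr0].
Qed.

Lemma inG_aut (t t' : V -> V) X R : linmap t -> linmap t' -> cancel t t' -> cancel t' t ->
  (forall v, X v -> R (t v)) -> (forall v, R v -> X (t' v)) -> inG X -> inG R.
Proof.
move=> lt lt' c c' hXR hRX [_ [g [lg gX Xg kg]]]; split; first exact: carrierP.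
exists (t \o g \o t'); split.
- split=> [x y|a x] /=; first by rewrite lt'.1 lg.1 lt.1.
  by rewrite lt'.2 lg.2 lt.2.
- by move=> v /=; apply: hXR.
- by move=> x Rx; have [v ev] := Xg _ (hRX _ Rx); exists (t v); rewrite /= c ev c'.
- move=> v /=; split=> [e|Rv].
    rewrite -[v]c'; apply: hXR; apply/kg; apply: (can_inj c).
    by rewrite e (linmap0 lt).
  by rewrite (kg _).2 ?(linmap0 lt) //; apply: hRX.
Qed.

Definition adj X Y := cov (caps X Y) X /\ cov (caps X Y) Y.

Lemma adj_sym X Y : adj X Y -> adj Y X.
Proof. by case=> h1 h2; split; rewrite capC. Qed.

Lemma adj_neq X Y : adj X Y -> X <> Y.
Proof. by move=> [/cov_neq h _] e; apply: h; rewrite {1}e capE. Qed.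

Hypothesis hK : division_ring K.

Lemma cov_cap_sum X Y : cov (caps X Y) X -> cov Y (sums X Y).
Proof.
move=> c; have lY : les (caps X Y) Y by apply: capr.
case: (cov_modular hK Y c) => -[].
  by rewrite (capE lY) => /cov_neq.
by rewrite (sumE lY).
Qed.

Lemma cov_sum_cap X Y : cov Y (sums X Y) -> cov (caps X Y) X.
Proof.
move=> c; have lX : les X (sums X Y) by apply: suml.
case: (cov_modular hK X c) => -[].
  by rewrite capC [caps (sums X Y) X]capC (capE lX).
by move=> _; rewrite [sums Y X]sumC [sums (sums X Y) X]sumC (sumE lX) => /cov_neq.
Qed.

Lemma adj_sums X Y : cov X (sums X Y) -> cov Y (sums X Y) -> adj X Y.
Proof.
move=> c1 c2; split; first exact: cov_sum_cap.
by rewrite capC; apply: cov_sum_cap; rewrite sumC.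
Qed.

(** A transvection carries [X] to [R]. If [x] and [r] complete [caps X R] to [X] and [R], it adds
    [p v *: (r - x)] to [v], where [p] vanishes on [caps X R] and on [x - r], and [p x = 1]. As
    [p (r - x) = 0], changing the sign gives the inverse. *)
Lemma inG_adj X R : adj X R -> inG X -> inG R.
Proof.
move=> [[x [nx eX]] [r [nr eR]]].
have Xx : X x by rewrite eX; apply: ext_self.
have Rr : R r by rewrite eR; apply: ext_self.
have [|p [[pD pZ] p0 px]] := @functional_sep _ _ hK (exts (caps X R) (x - r)) x.
  move=> /extP[a [y [Ay e]]]; apply: nr; split=> //.
  have [a0|a0] := eqVneq a 0; first by case: nx; rewrite e a0 scale0r addr0.
  apply: (subZ_inv hK a0); have -> : a *: r = y + a *: x - x.
    by rewrite {2}e scalerBr opprD opprB addrACA subrr add0r addrC subrK.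
  by apply: subB => //; apply: subD; [case: Ay|apply: subZ].
have pA y : caps X R y -> p y = 0 by move=> Ay; apply: p0; apply: ext_les.
have pxr : p (x - r) = 0 by apply: p0; apply: ext_self.
have prx : p (r - x) = 0.
  by rewrite -opprB -scaleN1r pZ pxr mulr0.
have pr : p r = 1 by rewrite -[r](subrK x) pD prx px add0r.
have pN y : p (- y) = - p y by rewrite -scaleN1r pZ mulN1r.
apply: (@inG_aut (fun v => v + p v *: (r - x)) (fun v => v - p v *: (r - x))).
- split=> [y z|a y]; first by rewrite pD scalerDl addrACA.
  by rewrite pZ [in RHS]scalerDr scalerA.
- split=> [y z|a y]; first by rewrite pD scalerDl opprD addrACA.
  by rewrite pZ [in RHS]scalerBr scalerA.
- by move=> v; rewrite pD pZ prx mulr0 addr0 addrK.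
- by move=> v; rewrite pD pN pZ prx mulr0 subr0 subrK.
- rewrite {1}eX => v /extP[a [y [Ay ->]]]; rewrite pD pZ pA // px add0r mulr1.
  rewrite -addrA -scalerDr [x + _]addrC subrK eR.
  by apply: subD; [apply: ext_les|apply/subZ/ext_self].
- rewrite {1}eR => v /extP[a [y [Ay ->]]]; rewrite pD pZ pA // pr add0r mulr1.
  rewrite -addrA -scalerBr opprB [r + _]addrC subrK eX.
  by apply: subD; [apply: ext_les|apply/subZ/ext_self].
Qed.

(* Three members of a pencil [{Z | A <= Z <= B}] with [dim B/A = 2]. *)
Definition pencil X Y R :=
  [/\ adj X Y, adj X R, adj Y R, les (caps X Y) R & les R (sums X Y)].

Lemma pencil_cap X Y R : pencil X Y R -> caps X R = caps X Y.
Proof.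
move=> [[cXY _] [cXR _] _ lR _].
have lc : les (caps X Y) (caps X R) by apply: les_cap => //; apply: capl.
by case: (cov_between hK cXY lc (@capl _ _ X R)) => // e; case: (cov_neq cXR).
Qed.

Lemma pencil_sum X Y R : pencil X Y R -> sums X R = sums X Y.
Proof.
move=> [[_ cXY] [_ cXR] _ _ lR].
have c1 : cov X (sums X Y).
  by rewrite sumC; apply: cov_cap_sum; rewrite capC.
have c2 : cov X (sums X R).
  by rewrite sumC; apply: cov_cap_sum; rewrite capC.
have lc : les (sums X R) (sums X Y) by apply: sum_les => //; apply: suml.
by case: (cov_between hK c1 (@suml _ _ X R) lc) => // e; case: (cov_neq c2).
Qed.

Lemma pencil_sym X Y R : pencil X Y R -> pencil Y X R.
Proof.
move=> [a1 a2 a3 l1 l2]; split=> //; first exact: adj_sym.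
  by rewrite capC.
by rewrite sumC.
Qed.

Lemma pencil_rot X Y R : pencil X Y R -> pencil X R Y.
Proof.
move=> h; have [a1 a2 a3 l1 l2] := h; split=> //; first exact: adj_sym.
  by rewrite (pencil_cap h); apply: capr.
by rewrite (pencil_sum h); apply: sumr.
Qed.

Lemma adj_cov_suml X Y : adj X Y -> cov X (sums X Y).
Proof. by move=> [_ c]; rewrite sumC; apply: cov_cap_sum; rewrite capC. Qed.

Lemma adj_cov_sumr X Y : adj X Y -> cov Y (sums X Y).
Proof. by move=> [c _]; apply: cov_cap_sum. Qed.

(** Because [z] lies outside both hyperplanes, [B] is spanned by [R] and [z] and also by [X] and
    [z]; as [z] belongs to [Z], either one yields the same sum with [Z]. *)
Lemma direct_sum_shift Z R X B z : cov R B -> cov X B -> Z z -> B z -> ~ R z -> ~ X z ->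
  direct_sum Z R -> direct_sum Z X.
Proof.
move=> cR cX Zz Bz nRz nXz [h1 h2].
have eR := cov_extE hK cR Bz nRz; have eX := cov_extE hK cX Bz nXz.
split=> [v Zv Xv|v].
  have: B v by apply: (cov_les cX).
  rewrite eR => /extP[a [r [Rr ev]]].
  have r0 : r = 0.
    apply: h1 => //; have -> : r = v - a *: z by rewrite ev addrK.
    by apply: subB => //; apply: subZ.
  have [a0|a0] := eqVneq a 0; first by rewrite ev r0 a0 scale0r addr0.
  by case: nXz; apply: (subZ_inv hK a0); move: Xv; rewrite ev r0 add0r.
have [z' [r [Zz' Rr ->]]] := h2 v.
have: B r by apply: (cov_les cR).
rewrite eX => /extP[a [x [Xx ->]]].
exists (z' + a *: z), x; split=> //; first by apply: subD => //; apply: subZ.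
by rewrite -addrA [_ *: _ + _]addrC.
Qed.

(** The pencil relation phrased through complements alone, so that it can be transported by a
    bijection that only sees members of [inG]. *)
Definition dominated X Y R := forall Z, inG Z -> direct_sum Z R ->
  direct_sum Z X \/ direct_sum Z Y.

(** A complement [Z] of [R] contains a vector [z] of [sums X Y] outside [R]. As [caps X Y] lies in
    [R], one of [X] and [Y] misses [z], and [R] can be traded for that one. *)
Lemma pencil_dominated X Y R : pencil X Y R -> dominated X Y R.
Proof.
move=> h Z _ dZ; have [a1 a2 a3 l1 l2] := h.
have eX := pencil_sum h; have eY := pencil_sum (pencil_sym h).
have cX := adj_cov_suml a1; have cY := adj_cov_sumr a1.
have cR : cov R (sums X Y) by rewrite -eX; apply: adj_cov_sumr.
have [x [Bx nRx]] := neq_sub (cov_les cR) (cov_neq cR).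
have [z [r [Zz Rr ex]]] := dZ.2 x.
have ez : z = x - r by rewrite ex addrK.
have Bz : sums X Y z by rewrite ez; apply: subB => //; apply: l2.
have nRz : ~ R z by move=> Rz; apply: nRx; rewrite ex; apply: subD.
have [Xz|nXz] := pselect (X z).
  right; apply: (direct_sum_shift cR cY Zz) => // Yz; apply: nRz.
  by apply: l1.
by left; apply: (direct_sum_shift cR cX Zz).
Qed.

Definition triad X Y R := [/\ X <> Y, X <> R & Y <> R] /\
  [/\ dominated X Y R, dominated X R Y & dominated Y R X].

Lemma dominated_sym X Y R : dominated X Y R -> dominated Y X R.
Proof. by move=> h Z GZ dZ; have := h Z GZ dZ; tauto. Qed.

Lemma triad_sym X Y R : triad X Y R -> triad Y X R.
Proof.
move=> [[n1 n2 n3] [h1 h2 h3]]; split; split=> //; first by move=> /esym.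
exact: dominated_sym.
Qed.

Lemma triad_rot X Y R : triad X Y R -> triad X R Y.
Proof.
move=> [[n1 n2 n3] [h1 h2 h3]]; split; split=> //; first by move=> /esym.
exact: dominated_sym.
Qed.

Lemma pencil_triad X Y R : pencil X Y R -> triad X Y R.
Proof.
move=> h; have [a1 a2 a3 l1 l2] := h; split; split; try exact: adj_neq.
- exact: pencil_dominated.
- exact/pencil_dominated/pencil_rot.
- exact/pencil_dominated/pencil_rot/pencil_sym.
Qed.

Lemma inG_complement X W : inG X -> (forall v, W v -> X v -> v = 0) ->
  exists Z, [/\ les W Z, inG Z & direct_sum Z X].
Proof.
move=> GX h; have [Z [lWZ dZ]] := complement_above hK h.
by exists Z; split=> //; apply: inG_compl dZ.
Qed.

Lemma direct_sum_nested Z X R : les X R -> direct_sum Z X -> direct_sum Z R -> X = R.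
Proof.
move=> lXR [_ h2] [h1 _]; apply: sub_ext => // v Rv.
have [z [x [Zz Xx e]]] := h2 v; suff z0 : z = 0 by rewrite e z0 add0r.
apply: h1 => //; have -> : z = v - x by rewrite e addrK.
by apply: subB => //; apply: lXR.
Qed.

(** Proper inclusions between members of [inG] do occur in infinite dimension. If [X] were inside
    [R], each complement of [X] would be one of [Y], which forces [Y] inside [X]; a complement of
    [R] would then also complement [X] or [Y], and nested subspaces with a common complement are
    equal. *)
Lemma triad_not_les X Y R : inG X -> inG R -> triad X Y R -> ~ les X R.
Proof.
move=> GX GR [[n1 n2 n3] [h1 h2 h3]] lXR.
have dY Z : inG Z -> direct_sum Z X -> direct_sum Z Y.
  by move=> GZ dZ; case: (h3 Z GZ dZ) => // /(direct_sum_nested lXR dZ).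
have lYX : les Y X.
  move=> v Yv; apply: contrapT => nXv.
  have [w Lw Xw|Z [lZ GZ dZ]] := @inG_complement X (lines v) GX.
    exact: (not_line hK nXv Xw Lw).
  have Zv : Z v by exact/lZ/line_self.
  by apply: nXv; rewrite ((dY Z GZ dZ).1 v) //; apply: sub0.
have [w -> _|Z [_ GZ dZ]] := @inG_complement R (zeros V) GR; first by [].
case: (h1 Z GZ dZ) => d; first by apply: n2; apply: (direct_sum_nested lXR d dZ).
by apply: n3; apply: (direct_sum_nested (les_trans lYX lXR) d dZ).
Qed.

(** A complement of [R] through a vector of [caps X Y] outside [R] would complement neither [X] nor
    [Y]. *)
Lemma dominated_cap X Y R : inG R -> dominated X Y R -> les (caps X Y) R.
Proof.
move=> GR h v [Xv Yv]; apply: contrapT => nRv.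
have [w Lw Rw|Z [lZ GZ dZ]] := @inG_complement R (lines v) GR.
  exact: (not_line hK nRv Rw Lw).
have Zv : Z v by exact/lZ/line_self.
by case: (h Z GZ dZ) => -[h1 _]; apply: nRv; rewrite (h1 v) //; apply: sub0.
Qed.

(** Otherwise the span of [x] and [y] meets [R] trivially, and a complement of [R] containing it
    meets both [X] and [Y]. *)
Lemma dominated_ext X Y R x y : inG R -> dominated X Y R ->
  X x -> ~ R x -> Y y -> ~ R y -> exts R y x.
Proof.
move=> GR h Xx nRx Yy nRy; apply: contrapT => nx.
have [w|Z [lZ GZ dZ]] := @inG_complement R (sums (lines x) (lines y)) GR.
  move=> [_ [_ [[a ->] [b ->] ->]]] Rw.
  have [a0|a0] := eqVneq a 0; last first.
    case: nx; apply: (subZ_inv hK a0).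
    have -> : a *: x = (a *: x + b *: y) - b *: y by rewrite addrK.
    by apply: subB; [apply: ext_les|apply/subZ/ext_self].
  move: Rw; rewrite a0 scale0r add0r => Rw.
  by apply: (not_line hK nRy Rw); exists b.
have Zx : Z x by apply/lZ/suml/line_self.
have Zy : Z y by apply/lZ/sumr/line_self.
case: (h Z GZ dZ) => -[h1 _].
  by apply: nRx; rewrite (h1 x) //; apply: sub0.
by apply: nRy; rewrite (h1 y) //; apply: sub0.
Qed.

(** With one [y] fixed, [dominated_ext] puts all of [X] into [exts R y]; after exchanging [x] and
    [y] the same argument applies to [Y]. *)
Lemma triad_sums X Y R : inG X -> inG Y -> inG R -> triad X Y R ->
  sums X R = sums Y R /\ cov R (sums X R).
Proof.
move=> GX GY GR t; have [_ [h _ _]] := t.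
have [x [Xx nRx]] := not_les (triad_not_les GX GR t).
have [y [Yy nRy]] := not_les (triad_not_les GY GR (triad_sym t)).
have exy := dominated_ext GR h Xx nRx Yy nRy.
have e := ext_exchange hK exy nRx.
have sX : sums X R = exts R y.
  apply: sub_ext; last first.
    by rewrite -e; apply: ext_leP; [apply: sumr|apply: suml].
  apply: sum_les; last exact: ext_les.
  move=> x' Xx'; have [Rx'|nRx'] := pselect (R x'); first exact: ext_les.
  exact: (dominated_ext GR h Xx' nRx' Yy nRy).
have sY : sums Y R = exts R y.
  apply: sub_ext; last by apply: ext_leP; [apply: sumr|apply: suml].
  apply: sum_les; last exact: ext_les.
  move=> y' Yy'; have [Ry'|nRy'] := pselect (R y'); first exact: ext_les.
  by rewrite -e; apply: (dominated_ext GR (dominated_sym h) Yy' nRy' Xx nRx).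
by rewrite sX sY; split=> //; apply: cov_ext.
Qed.

Lemma triad_adj X Y R : inG X -> inG Y -> inG R -> triad X Y R -> adj X Y.
Proof.
move=> GX GY GR t; apply: adj_sums.
  by have [_] := triad_sums GY GR GX (triad_rot (triad_sym t)); rewrite sumC.
by have [_] := triad_sums GX GR GY (triad_rot t).
Qed.

Lemma triad_pencil X Y R : inG X -> inG Y -> inG R -> triad X Y R -> pencil X Y R.
Proof.
move=> GX GY GR t; split; first exact: (triad_adj GX GY GR t).
- exact: (triad_adj GX GR GY (triad_rot t)).
- exact: (triad_adj GY GR GX (triad_rot (triad_sym t))).
- by have [_ [h _ _]] := t; apply: dominated_cap.
have [e _] := triad_sums GX GR GY (triad_rot t).
by rewrite e; apply: suml.
Qed.

Lemma adj_pencil X Y : adj X Y -> exists R, pencil X Y R.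
Proof.
move=> a; have [[x [nx eX]] [y [ny eY]]] := a.
(* The vector [x + y] yields a third member over every division ring, even over the field with two
   elements. *)
pose A := caps X Y; pose R := exts A (x + y).
have Xx : X x by rewrite eX; apply: ext_self.
have Yy : Y y by rewrite eY; apply: ext_self.
have nXy : ~ X y by move=> Xy; apply: ny.
have nYx : ~ Y x by move=> Yx; apply: nx.
have nXxy : ~ X (x + y).
  by move=> h; apply: nXy; have -> : y = x + y - x; [rewrite addrAC subrr add0r|apply: subB].
have nYxy : ~ Y (x + y).
  by move=> h; apply: nYx; have -> : x = x + y - y; [rewrite addrK|apply: subB].
have cR : cov A R by apply: cov_ext => -[].
have gen Z : cov A Z -> ~ Z (x + y) -> adj Z R.
  move=> cZ nZ; have e : caps Z R = A.
    have l : les A (caps Z R) by apply: les_cap; apply: cov_les.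
    case: (cov_between hK cR l (@capr _ _ Z R)) => // e.
    by case: nZ; apply: (@capl _ _ Z R); rewrite e; apply: ext_self.
  by split; rewrite e.
exists R; split=> //.
- by apply: gen => //; case: a.
- by apply: gen => //; case: a.
- exact: cov_les.
- apply: ext_leP; first by apply: les_trans (@suml _ _ _ _); apply: capl.
  by exists x, y.
Qed.

End Adjacency.

(** * Images under linear maps, and coordinates *)

Section Image.
Variables (K : unitRingType) (U V : lmodType K) (g : U -> V).
Hypotheses (hK : division_ring K) (lg : linmap g).
Implicit Types (A B : sub U).

Lemma im_subspace A : subspace (fun v => exists u, A u /\ g u = v).
Proof.
split=> [|_ _ [x [Ax <-]] [y [Ay <-]]|a _ [x [Ax <-]]].
- by exists 0; rewrite (linmap0 lg); split=> //; apply: sub0.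
- by exists (x + y); rewrite lg.1; split=> //; apply: subD.
- by exists (a *: x); rewrite lg.2; split=> //; apply: subZ.
Qed.
Definition ims A := Sub (im_subspace A).

Lemma cov_im A B : cov A B -> (forall x y, B x -> B y -> g x = g y -> x = y) ->
  cov (ims A) (ims B).
Proof.
move=> [v [nAv eB]] inj; exists (g v).
have Bv : B v by rewrite eB; apply: ext_self.
have lAB : les A B by rewrite eB; apply: ext_les.
split=> [[u [Au e]]|].
  by apply: nAv; rewrite -(inj u v) //; apply: lAB.
apply: sub_ext => [_ [u [Bu <-]]|].
  move: Bu; rewrite eB => /extP[a [y [Ay ->]]]; rewrite lg.1 lg.2.
  by apply: subD; [apply: ext_les; exists y|apply/subZ/ext_self].
apply: ext_leP; last by exists v.
by move=> _ [u [/lAB Bu <-]]; exists u.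
Qed.

Lemma hasdim_im k A : (forall x y, A x -> A y -> g x = g y -> x = y) ->
  hasdim k A -> hasdim k (ims A).
Proof.
elim: k A => [|k IH] A inj /=.
  move=> ->; apply: sub_ext; last exact: les0.
  by move=> _ [u [-> <-]]; rewrite (linmap0 lg).
move=> [B [dB cBA]]; exists (ims B); split; last exact: cov_im.
by apply: IH => // x y Bx By; apply: inj; apply: (cov_les cBA).
Qed.

End Image.

Section HasDim.
Variable K : unitRingType.
Hypothesis hK : division_ring K.

Lemma hasdim_row n : hasdim n (fulls 'rV[K]_n).
Proof.
elim: n => [|n IH].
  by apply: sub_ext => // v _; rewrite /= [v]thinmx0.
pose g (u : 'rV[K]_n) : 'rV[K]_(1 + n) := row_mx 0 u.
have lg : linmap g.
  by split=> [x y|a x]; rewrite /g ?add_row_mx ?scale_row_mx ?addr0 ?scaler0.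
exists (ims lg (fulls _)); split.
  by apply: hasdim_im => // x y _ _ /(congr1 (@rsubmx _ 1 1 n)); rewrite /g !row_mxKr.
pose w : 'rV[K]_(1 + n) := row_mx 1 0.
exists w; split.
  move=> [u [_ /(congr1 (@lsubmx _ 1 1 n))]]; rewrite /g /w !row_mxKl => /matrixP/(_ 0 0).
  by rewrite !mxE => /esym/eqP; rewrite oner_eq0.
apply: sub_ext => // v _.
exists (g (@rsubmx _ 1 1 n v)), ((v 0 0 : K) *: w); split.
- by exists (@rsubmx _ 1 1 n v).
- by exists (v 0 0).
apply/matrixP => i j; rewrite !mxE !ord1.
by case: (@splitP 1 n j) => j' e; rewrite !mxE ?ord1 ?mulr1n ?mulr1 ?add0r ?mulr0 ?addr0;
  congr (v _ _); apply: val_inj; rewrite /= e ?ord1.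
Qed.

Variable V : lmodType K.

Lemma bij_inv_linmap (U W : lmodType K) (f : U -> W) (h : W -> U) :
  linmap f -> cancel f h -> cancel h f -> linmap h.
Proof.
move=> lf c1 c2; split=> [x y|a x]; apply: (can_inj c1).
  by rewrite lf.1 !c2.
by rewrite lf.2 !c2.
Qed.

Lemma has_dim_hasdim n : has_dim V n -> hasdim n (fulls V).
Proof.
move=> [f [lf [h c1 c2]]]; have lh := bij_inv_linmap lf c1 c2.
have -> : fulls V = ims lh (fulls _).
  by apply: sub_ext => // v _; exists (f v).
by apply: hasdim_im => //; [move=> x y _ _; apply: (can_inj c2)|apply: hasdim_row].
Qed.

Lemma hasdim_coordinates k (A : sub V) : hasdim k A -> exists h : 'rV[K]_k -> V,
  [/\ linmap h, injective h, forall r, A (h r) & forall v, A v -> exists r, h r = v].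
Proof.
elim: k A => [|k IH] A /=.
  move=> ->; exists (fun _ => 0); split=> //.
  - by split=> *; rewrite ?addr0 ?scaler0.
  - by move=> x y _; rewrite [x]thinmx0 [y]thinmx0.
  - by move=> v ->; exists 0.
move=> [B [/IH[h [lh inj hB Bh]] [v [nBv ->]]]].
pose h' (r : 'rV[K]_(1 + k)) := h (rsubmx r) + r 0 0 *: v.
have eq0 r : h' r = 0 -> r = 0.
  rewrite /h' => e; have r0 : r 0 0 = 0.
    apply: contrapT => /eqP r0; apply: nBv; apply: (subZ_inv hK r0).
    have -> : r 0 0 *: v = - h (rsubmx r).
      by apply/eqP; rewrite -addr_eq0 addrC e.
    exact/subN/hB.
  have r1 : rsubmx r = 0.
    by apply: inj; rewrite (linmap0 lh) -e r0 scale0r addr0.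
  rewrite -[r]hsubmxK r1; apply/matrixP => i j; rewrite !mxE ord1.
  case: splitP => [j' _|j' _]; rewrite !mxE // ord1 -[RHS]r0.
  by congr (r _ _); apply: val_inj.
have lh' : linmap h'.
  split=> [x y|a x]; rewrite /h'.
    by rewrite linearD /= lh.1 mxE scalerDl addrACA.
  by rewrite linearZ /= lh.2 mxE scalerDr scalerA.
exists h'; split=> //.
- move=> x y e; apply/eqP; rewrite -subr_eq0; apply/eqP; apply: eq0.
  by rewrite (linmapB _ _ lh') e subrr.
- by move=> r; apply: subD; [apply/ext_les/hB|apply/subZ/ext_self].
move=> w /extP[a [y [/Bh[r <-] ->]]].
exists (row_mx a%:M r); rewrite /h' row_mxKr; congr (_ + _ *: _).
have -> : (0 : 'I_(1 + k)) = lshift k 0 by apply: val_inj.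
by rewrite row_mxEl mxE eqxx mulr1n.
Qed.

Lemma hasdim_has_dim n : hasdim n (fulls V) -> has_dim V n.
Proof.
move=> /hasdim_coordinates[h [lh inj _ surj]].
have [f hf] := choice (fun v => surj v I).
have c : cancel h f by move=> r; apply: inj.
exists f; split; last by exists h.
exact: bij_inv_linmap lh c hf.
Qed.

Hypothesis hfin : findim (fulls V).

Lemma inG_dims (X : sub V) : inG X -> (2 * dims X = dims (fulls V))%N.
Proof.
move=> GX; have [_ [g [lg gX Xg kg]]] := GX.
have [w -> _|Z [_ _ dZ]] := @inG_complement _ _ hK X (zeros V) GX; first by [].
rewrite -(direct_sum_dims hK hfin dZ) mul2n -addnn; congr (_ + _)%N.
have -> : X = ims lg Z.
  apply: sub_ext => [x /Xg[v <-]|_ [z [_ <-]]]; last exact: gX.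
  have [z [y [Zz Xy ->]]] := dZ.2 v; exists z; split=> //.
  by rewrite lg.1 ((kg y).2 Xy) addr0.
apply: dims_eq => //; apply: hasdim_im => //; last exact: dimsP.
move=> x y Zx Zy e; apply/eqP; rewrite -subr_eq0; apply/eqP.
apply: dZ.1; first exact: subB.
by apply/kg; rewrite (linmapB _ _ lg) e subrr.
Qed.

End HasDim.

(** * Paths in the adjacency graph *)

Section Paths.
Variables (K : unitRingType) (V : lmodType K).
Hypothesis hK : division_ring K.
Implicit Types (X Y Z R : sub V).

Fixpoint adj_path k X Y : Prop :=
  if k is k'.+1 then exists Z, adj X Z /\ adj_path k' Z Y else X = Y.

(** One adjacency step raises the intersection with a fixed [R] by at most one dimension. Finiteness
    is not assumed, so this can bound subspaces of [V']. *)
Lemma adj_path_cap k X Y R j : adj_path k X Y ->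
  (exists d, (d <= j)%N /\ hasdim d (caps Y R)) ->
  exists d, (d <= j + k)%N /\ hasdim d (caps X R).
Proof.
elim: k X => [|k IH] X /=; first by move=> ->; rewrite addn0.
move=> [Z [[c1 _] p]] /(IH _ p)[d [ld dd]].
have [|e [le de _]] := @hasdim_les _ _ hK _ _ (caps (caps X Z) R) dd.
  by apply: les_cap; [apply: (les_trans (@capl _ _ _ _)); apply: capr|apply: capr].
case: (cov_modular hK R c1) => -[h _].
  exists e.+1; split; first by rewrite addnS ltnS (leq_trans le).
  by exists (caps (caps X Z) R).
by exists e; rewrite -h; split=> //; lia.
Qed.

Hypothesis hfin : findim (fulls V).

(** Replace one vector: a hyperplane [H] of [X] through [caps X Y], extended by a [y] of [Y] outside
    [X], is adjacent to [X] and meets [Y] in a larger subspace. *)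
Lemma adj_path_exists k X Y : dims X = dims Y -> (dims X <= dims (caps X Y) + k)%N ->
  exists2 l, (l <= k)%N & adj_path l X Y.
Proof.
elim: k X => [|k IH] X eXY lXY.
  exists 0%N => //=; have e : caps X Y = X.
    by apply: dims_les_eq => //; [apply: capl|rewrite addn0 in lXY].
  by apply: dims_les_eq; rewrite ?eXY // -e; apply: capr.
have [lYX|/not_les[y [Yy nXy]]] := pselect (les Y X).
  by exists 0%N => //=; symmetry; apply: dims_les_eq; rewrite ?eXY.
have lt : (dims (caps X Y) < dims X)%N.
  rewrite ltnNge; apply/negP => le; apply: nXy.
  have e : caps X Y = X by apply: dims_les_eq => //; apply: capl.
  have -> // : X = Y.
  by apply: dims_les_eq; rewrite ?eXY // -e; apply: capr.
have [||H [l1 l2 eH]] := @interpolate _ _ hK hfin (caps X Y) X (dims X).-1 (@capl _ _ X Y).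
- lia.
- lia.
have nHy : ~ H y by move=> /l2.
pose Z := exts H y.
have cHX : cov H X by apply: cov_dims; rewrite ?eH //; lia.
have cHZ : cov H Z by apply: cov_ext.
have eXZ : caps X Z = H.
  have l : les H (caps X Z) by apply: les_cap => //; apply: cov_les.
  case: (cov_between hK cHZ l (@capr _ _ X Z)) => // e; case: nXy.
  by apply: (@capl _ _ X Z); rewrite e; apply: ext_self.
have eZ : dims Z = dims Y by rewrite (dims_cov hK hfin cHZ) -(dims_cov hK hfin cHX).
have lZ : (dims (caps X Y) < dims (caps Z Y))%N.
  have <- : dims (exts (caps X Y) y) = (dims (caps X Y)).+1.
    by apply: dims_ext => // -[].
  apply: dims_les => //; apply: ext_leP; last by split=> //; apply: ext_self.
  by apply: les_cap; [apply: (les_trans l1); apply: ext_les|apply: capr].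
have [|l ll p] := IH Z eZ; first by lia.
by exists l.+1 => //=; exists Z; split=> //; split; rewrite eXZ.
Qed.

Lemma inG_adj_path k X Y : adj_path k X Y -> inG X -> inG Y.
Proof.
elim: k X => [|k IH] X /=; first by move=> ->.
by move=> [Z [a p]] GX; apply: (IH Z p); apply: inG_adj GX.
Qed.

Lemma dims_inG m X Y : dims (fulls V) = (2 * m)%N -> inG X -> dims Y = m -> inG Y.
Proof.
move=> dV GX dY; have := inG_dims hK hfin GX; rewrite dV => e.
have e1 : dims X = dims Y by lia.
have l1 : (dims X <= dims (caps X Y) + m)%N by lia.
have [k _ p] := adj_path_exists e1 l1.
exact: inG_adj_path p GX.
Qed.

End Paths.

(** The maps live on all subspaces, with arbitrary values off [inG]. This avoids dependent pairs and
    makes composition with the annihilator immediate. *)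
Definition compl_iso (K K' : unitRingType) (V : lmodType K) (V' : lmodType K')
    (Phi : sub V -> sub V') (Psi : sub V' -> sub V) :=
  [/\ forall X : sub V, inG X -> inG (Phi X), forall Y : sub V', inG Y -> inG (Psi Y),
      forall X : sub V, inG X -> Psi (Phi X) = X, forall Y : sub V', inG Y -> Phi (Psi Y) = Y &
      forall X Y : sub V, inG X -> inG Y ->
        (direct_sum X Y <-> direct_sum (Phi X) (Phi Y))].

(** * Bijections preserving complements *)

Section ComplIsoTheory.
Variables (K K' : unitRingType) (hK : division_ring K) (hK' : division_ring K').
Variables (V : lmodType K) (V' : lmodType K').
Variables (Phi : sub V -> sub V') (Psi : sub V' -> sub V).
Implicit Types (X Y R : sub V).
Hypothesis iso : compl_iso Phi Psi.

Lemma compl_iso_sym : compl_iso Psi Phi.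
Proof.
have [h1 h2 h3 h4 h5] := iso; split=> // X Y GX GY.
by rewrite h5 ?h4 //; apply: h2.
Qed.

Lemma compl_iso_inj X Y : inG X -> inG Y -> Phi X = Phi Y -> X = Y.
Proof. by have [_ _ h _ _] := iso => GX GY e; rewrite -(h X) // e h. Qed.

Lemma compl_iso_dominated X Y R : inG X -> inG Y -> inG R ->
  dominated X Y R -> dominated (Phi X) (Phi Y) (Phi R).
Proof.
have [h1 h2 h3 h4 h5] := iso => GX GY GR h Z GZ; have GP := h2 Z GZ.
rewrite -(h4 Z GZ) => /(h5 _ _ GP GR)/(h _ GP)[] d; [left|right]; exact/h5.
Qed.

Lemma compl_iso_pencil X Y R : inG X -> inG Y -> inG R ->
  pencil X Y R -> pencil (Phi X) (Phi Y) (Phi R).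
Proof.
move=> GX GY GR /(pencil_triad hK)[[n1 n2 n3] [h1 h2 h3]].
have [hG _ _ _ _] := iso; apply: triad_pencil; [exact: hK'|exact: hG..|].
split; split.
- by move/(compl_iso_inj GX GY).
- by move/(compl_iso_inj GX GR).
- by move/(compl_iso_inj GY GR).
- exact: compl_iso_dominated.
- exact: compl_iso_dominated.
- exact: compl_iso_dominated.
Qed.

Lemma compl_iso_adj X Y : inG X -> inG Y -> adj X Y -> adj (Phi X) (Phi Y).
Proof.
move=> GX GY a; have [R p] := adj_pencil hK a; have [_ aXR _ _ _] := p.
by have [] := compl_iso_pencil GX GY (inG_adj hK aXR GX) p.
Qed.

Lemma compl_iso_adj_path k X Y : inG X -> adj_path k X Y -> adj_path k (Phi X) (Phi Y).
Proof.
elim: k X => [|k IH] X GX /=; first by move=> ->.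
move=> [Z [a p]]; have GZ := inG_adj hK a GX; exists (Phi Z); split.
  exact: compl_iso_adj.
exact: IH.
Qed.

(** Complementary members of [inG] are joined by a path of length at most [m]. Its image joins two
    subspaces that meet in 0, so each has dimension at most [m]; and together they span [V']. *)
Lemma compl_iso_dims_le m X0 : findim (fulls V) -> dims (fulls V) = (2 * m)%N -> inG X0 ->
  findim (fulls V') /\ (dims (fulls V') <= 2 * m)%N.
Proof.
move=> hfin dV GX; have [hG _ _ _ h5] := iso.
have [w -> _|Y [_ GY dYX]] := @inG_complement _ _ hK X0 (zeros V) GX; first by [].
have bound (X Z : sub V) : inG X -> inG Z -> direct_sum X Z ->
    exists d, (d <= m)%N /\ hasdim d (Phi X).
  move=> GX1 GZ d; have dX := inG_dims hK hfin GX1; have dZ := inG_dims hK hfin GZ.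
  have [||k lk p] := @adj_path_exists _ _ hK hfin m X Z; [lia|lia|].
  have [|e [le de]] := @adj_path_cap _ _ hK' k (Phi X) (Phi Z) (Phi X) 0 (compl_iso_adj_path GX1 p).
    exists 0%N; split=> //=; apply: sub_ext; last exact: les0.
    move=> v [Zv Xv]; have [h _] := (h5 X Z GX1 GZ).1 d; exact: h.
  by exists e; split; [lia|rewrite capE in de].
have [d1 [l1 e1]] := bound _ _ GY GX dYX.
have [d2 [l2 e2]] := bound _ _ GX GY (direct_sumC dYX).
have [c [d [_ dd e]]] := hasdim_modular hK' e1 e2.
have eF : sums (Phi Y) (Phi X0) = fulls V'.
  by apply: sub_ext => // v _; have [_ h] := (h5 Y X0 GY GX).1 dYX; apply: h.
rewrite eF in dd; split; first by exists d.
by rewrite (dims_eq hK' dd); lia.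
Qed.

End ComplIsoTheory.

(** * The fundamental theorem of projective geometry *)

Lemma inj_surj_bijective (T U : Type) (f : T -> U) :
  injective f -> (forall y, exists x, f x = y) -> bijective f.
Proof.
move=> inj surj; have [h hh] := choice surj.
by exists h => // x; apply: inj; rewrite hh.
Qed.

Section FundamentalTheorem.
Variables (K K' : unitRingType) (hK : division_ring K) (hK' : division_ring K').
Variables (V : lmodType K) (V' : lmodType K').
(** [Q x] is the image of the point spanned by [x], and is unconstrained at 0. The hypothesis
    [dim_ge4] says that the dimension is at least 4. *)
Variable Q : V -> sub V'.

Definition span2 (x y : V) := sums (lines x) (lines y).

Hypothesis Q_line : forall x, x <> 0 -> exists q, q <> 0 /\ Q x = lines q.
Hypothesis Q_surj : forall v, v <> 0 -> exists x, x <> 0 /\ Q x v.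
Hypothesis Q_span : forall x y z, x <> 0 -> y <> 0 -> z <> 0 ->
  (span2 x y z <-> les (Q z) (sums (Q x) (Q y))).
Hypothesis dim_ge4 : forall a b c, exists z, ~ exts (span2 a b) c z.

Lemma span2P x y z : span2 x y z -> exists a b : K, z = a *: x + b *: y.
Proof. by move=> [_ [_ [[a ->] [b ->] ->]]]; exists a, b. Qed.

Lemma span2l x y : span2 x y x. Proof. exact/suml/line_self. Qed.
Lemma span2r x y : span2 x y y. Proof. exact/sumr/line_self. Qed.

Lemma span2_diag x z : span2 x x z -> lines x z.
Proof. by move=> /span2P[a [b ->]]; exists (a + b); rewrite scalerDl. Qed.

Lemma Q_eq_line x v : x <> 0 -> v <> 0 -> Q x v -> Q x = lines v.
Proof.
move=> /Q_line[q [q0 ->]] v0 [a e]; rewrite e; have a0 : a != 0.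
  by apply/eqP => a0; apply: v0; rewrite e a0 scale0r.
apply: sub_ext; last by apply: line_les; exists a.
by apply: line_les; exists a^-1; rewrite unscale.
Qed.

(** A vector common to two image lines spans a point that comes from a common point of the original
    lines. Vectors are identified below through such intersections. *)
Lemma Q_meet x y z w v : x <> 0 -> y <> 0 -> z <> 0 -> w <> 0 -> v <> 0 ->
  sums (Q x) (Q y) v -> sums (Q z) (Q w) v ->
  exists u, [/\ u <> 0, Q u v, span2 x y u & span2 z w u].
Proof.
move=> x0 y0 z0 w0 v0 h1 h2; have [u [u0 Qu]] := Q_surj v0.
by exists u; split=> //; apply/Q_span => //; rewrite (Q_eq_line u0 v0 Qu); apply: line_les.
Qed.

Lemma Q_meet1 x y v : x <> 0 -> y <> 0 -> v <> 0 -> Q x v -> Q y v -> lines x y.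
Proof.
move=> x0 y0 v0 h1 h2.
have [u [u0 _ /span2_diag hx /span2_diag[a e]]] :=
  Q_meet x0 x0 y0 y0 v0 (suml (Q x) h1) (suml (Q y) h2).
have a0 : a != 0 by apply/eqP => a0; apply: u0; rewrite e a0 scale0r.
by apply: (subZ_inv hK a0); rewrite -e.
Qed.

Lemma Q_mono x y : x <> 0 -> y <> 0 -> lines x y -> les (Q y) (Q x).
Proof.
move=> x0 y0 h; have e : les (Q y) (sums (Q x) (Q x)) by apply/Q_span => //; apply: suml.
by apply: (les_trans e); apply: sum_les.
Qed.

Section Frame.
Variables (e : V) (e' : V').
Hypotheses (e_neq0 : e <> 0) (e'_neq0 : e' <> 0) (Qe : Q e = lines e').

Lemma nline_neq0 x : ~ lines e x -> x <> 0.
Proof. by move=> h x0; apply: h; rewrite x0; apply: sub0. Qed.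

Lemma nline_shift x y : lines e y -> ~ lines e x -> ~ lines e (y + x).
Proof. by move=> hy h h'; apply: h; rewrite -(addKr y x) addrC; apply: subB. Qed.

Definition free2 x y := ~ lines e x /\ ~ exts (lines e) x y.

Lemma free2_coef x y a b c a' b' c' : free2 x y ->
  a *: e + b *: x + c *: y = a' *: e + b' *: x + c' *: y -> [/\ a = a', b = b' & c = c'].
Proof.
move=> [nx ny] /eqP; rewrite -subr_eq0 !opprD (addrACA (_ + _)) (addrACA (_ *: e)).
rewrite -!scalerBl => /eqP h.
have ec : c = c'.
  apply/eqP; rewrite -subr_eq0; apply/negPn/negP => c0; apply: ny.
  apply: (subZ_inv hK c0); rewrite -[_ *: y](addKr ((a - a') *: e + (b - b') *: x)) h addr0.
  apply: subN; apply: subD; first by apply/ext_les/subZ/line_self.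
  exact/subZ/ext_self.
move: h; rewrite ec subrr scale0r addr0 => h.
have eb : b = b'.
  apply/eqP; rewrite -subr_eq0; apply/negPn/negP => b0; apply: nx.
  apply: (subZ_inv hK b0); rewrite -[_ *: x](addKr ((a - a') *: e)) h addr0.
  exact/subN/subZ/line_self.
move: h; rewrite eb subrr scale0r addr0 => h.
by split=> //; apply/eqP; rewrite -subr_eq0; apply/eqP; apply: (scale_eq0 hK h).
Qed.

Lemma lines_swap (x y : V) : y <> 0 -> lines x y -> lines y x.
Proof.
move=> y0 [a ea]; have a0 : a != 0 by apply/eqP => a0; apply: y0; rewrite ea a0 scale0r.
by exists a^-1; rewrite ea unscale.
Qed.

Lemma shift_neq0 x : ~ lines e x -> e + x <> 0.
Proof. by move=> nx; apply/nline_neq0/nline_shift => //; apply: line_self. Qed.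

Lemma Q_disj x v : ~ lines e x -> Q x v -> Q (e + x) v -> v = 0.
Proof.
move=> nx h1 h2; apply: contrapT => v0; apply: (nx); apply: lines_swap => //.
have h := Q_meet1 (nline_neq0 nx) (shift_neq0 nx) v0 h1 h2.
by rewrite -[e](addrK x); apply: subB => //; apply: line_self.
Qed.

Lemma Q_disj_e x v : ~ lines e x -> Q x v -> Q e v -> v = 0.
Proof.
move=> nx h1 h2; apply: contrapT => v0; apply: (nx).
by apply: (Q_meet1 _ _ v0 h2 h1) => //; apply: nline_neq0.
Qed.

(* The vector of [Q x] normalised by the position of its translate by [e']. *)
Definition lift x x' := Q x x' /\ Q (e + x) (e' + x').

Lemma lift_exists x : ~ lines e x -> exists x', lift x x'.
Proof.
move=> nx; have x0 := nline_neq0 nx; have ex0 := shift_neq0 nx.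
have [q [q0 eq]] := Q_line ex0.
have h : les (Q (e + x)) (sums (Q e) (Q x)).
  by apply/Q_span => //; apply: subD; [apply: span2l|apply: span2r].
have Qq : Q (e + x) q by rewrite eq; apply: line_self.
have [y [x1 [+ Qx1 ex1]]] := h q Qq; rewrite Qe => -[a ea].
have a0 : a != 0.
  apply/eqP => a0; apply: q0; apply: (Q_disj nx _ Qq).
  by rewrite ex1 ea a0 scale0r add0r.
exists (a^-1 *: x1); split; first exact: subZ.
have -> : e' + a^-1 *: x1 = a^-1 *: q by rewrite ex1 ea scalerDr unscale.
exact: subZ.
Qed.

Lemma lift_uniq x x' x'' : ~ lines e x -> lift x x' -> lift x x'' -> x' = x''.
Proof.
move=> nx [h1 h2] [h3 h4]; apply/eqP; rewrite -subr_eq0; apply/eqP.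
apply: (Q_disj nx); first exact: subB.
have -> : x' - x'' = (e' + x') - (e' + x'') by rewrite opprD addrACA subrr add0r.
exact: subB.
Qed.

Lemma lift_neq0 x x' : ~ lines e x -> lift x x' -> x' <> 0.
Proof.
move=> nx [_ +] e0; rewrite e0 addr0 => h; apply: e'_neq0.
apply: (@Q_disj_e (e + x)) => //; first by apply: nline_shift => //; apply: line_self.
by rewrite Qe; apply: line_self.
Qed.

Lemma free2_nline x y : free2 x y -> ~ lines e y.
Proof. by move=> [_ h] ly; apply/h/ext_les. Qed.

Lemma free2_nline_sum x y : free2 x y -> ~ lines e (x + y).
Proof.
move=> [nx h] ly; apply: h; rewrite -(addKr x y) addrC.
by apply: subB; [apply: ext_les|apply: ext_self].
Qed.

Lemma Q_mono_scale c w u v : w <> 0 -> u <> 0 -> u = c *: w -> Q u v -> Q w v.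
Proof. by move=> w0 u0 eu; apply: Q_mono => //; exists c. Qed.

(* <x + y> is the intersection of <x, y> with <e + x + y, e>, and <e + x + y> that of
   <e + x, y> with <e + y, x>. *)
Lemma lift_free x y x' y' : free2 x y -> lift x x' -> lift y y' -> lift (x + y) (x' + y').
Proof.
move=> fxy [Qx Qex] [Qy Qey].
have nx := fxy.1; have ny := free2_nline fxy; have nxy := free2_nline_sum fxy.
have x0 := nline_neq0 nx; have y0 := nline_neq0 ny; have xy0 := nline_neq0 nxy.
have ex0 := shift_neq0 nx; have ey0 := shift_neq0 ny; have exy0 := shift_neq0 nxy.
have Qexy : Q (e + (x + y)) (e' + (x' + y')).
  have [-> |/eqP v0] := eqVneq (e' + (x' + y')) 0; first exact: sub0.
  have [|||||||u [u0 Qu /span2P[a [b e1]] /span2P[c [d e2]]]] :=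
    @Q_meet (e + x) y (e + y) x (e' + (x' + y')) => //.
  - by exists (e' + x'), y'; rewrite addrA.
  - by exists (e' + y'), x'; split=> //; rewrite [x' + _]addrC addrA.
  (* Comparing the two expressions of [u] in the independent vectors [e], [x], [y] makes [u] a
     multiple of [e + x + y]. *)
  have [eac ead ebc] : [/\ a = c, a = d & b = c].
    apply: (free2_coef fxy); rewrite -scalerDr -e1 e2 scalerDr addrAC; by [].
  apply: (@Q_mono_scale a _ u) => //.
  by rewrite e1 ebc eac -scalerDr addrA.
split=> //.
have [-> |/eqP v0] := eqVneq (x' + y') 0; first exact: sub0.
have [|||||||u [u0 Qu /span2P[a [b e1]] /span2P[c [d e2]]]] :=
  @Q_meet x y (e + (x + y)) e (x' + y') => //.
- by exists x', y'.
- exists (e' + (x' + y')), (- e'); split=> //; last by rewrite [RHS]addrC addKr.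
  by apply: subN; rewrite Qe; apply: line_self.
have [_ eac ebc] : [/\ 0 = c + d, a = c & b = c].
  apply: (free2_coef fxy); rewrite scale0r add0r -e1 e2 !scalerDr scalerDl.
  by rewrite addrC addrA [d *: e + _]addrC addrA.
apply: (@Q_mono_scale a _ u) => //.
by rewrite e1 ebc eac -scalerDr.
Qed.

Local Notation L := (lines e).

Lemma avoid x y : exists z, ~ exts (exts L x) y z.
Proof. exact: dim_ge4. Qed.

Lemma avoid1 x : exists z, ~ exts L x z.
Proof. by have [z hz] := avoid x 0; exists z => h; apply/hz/ext_les. Qed.

Variable f : V -> V'.
Hypothesis fP : forall x, ~ L x -> lift x (f x).

Lemma f_free x y : free2 x y -> f (x + y) = f x + f y.
Proof.
move=> fxy; apply: (lift_uniq (free2_nline_sum fxy)); first exact/fP/free2_nline_sum.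
by apply: (lift_free fxy); apply: fP; [apply: fxy.1|apply: free2_nline fxy].
Qed.

(** If [e], [x], [y] are dependent, take [z] outside the span of [e] and [x] and expand
    [f (x + y + z)] in two ways, using free sums only. *)
Lemma f_add x y : ~ L x -> ~ L y -> ~ L (x + y) -> f (x + y) = f x + f y.
Proof.
move=> nx ny nxy; have [h|h] := pselect (exts L x y); last exact: f_free.
have [z nz] := avoid1 x.
have nL w : exts L x w -> ~ exts L w z.
  by move=> hw hz; apply: nz; apply: (ext_leP _ hw) hz; apply: ext_les.
have hxy : exts L x (x + y) by apply: subD => //; apply: ext_self.
have e1 : f (x + y + z) = f (x + y) + f z by apply: f_free; split=> //; apply: nL.
have e2 : f (y + z) = f y + f z by apply: f_free; split=> //; apply: nL.
have e3 : f (x + (y + z)) = f x + f (y + z).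
  apply: f_free; split=> // h'; apply: nz; rewrite -(addKr y z) addrC.
  exact: subB.
by apply: (addIr (f z)); rewrite -e1 -addrA e3 e2 addrA.
Qed.

Lemma nexts_nline x z : ~ exts L x z -> ~ L z.
Proof. by move=> h hz; apply/h/ext_les. Qed.

Lemma nexts_nline_sum x z : ~ exts L x z -> ~ L (x + z).
Proof.
move=> h hz; apply: h; rewrite -(addKr x z) addrC.
by apply: subB; [apply: ext_les|apply: ext_self].
Qed.

Lemma f_diff_step x z w : ~ exts L x z -> ~ exts L x w -> ~ L (x + z + w) ->
  f (x + z) - f z = f (x + w) - f w.
Proof.
move=> hz hw h.
have E1 : f (x + z + w) = f (x + z) + f w.
  by apply: f_add => //; [apply: nexts_nline_sum|apply: nexts_nline hw].
have E2 : f (x + z + w) = f (x + w) + f z.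
  rewrite addrAC in h *.
  by apply: f_add => //; [apply: nexts_nline_sum|apply: nexts_nline hz].
by apply/eqP; rewrite subr_eq addrAC eq_sym subr_eq -E1 E2.
Qed.

(** When [x + z + w] falls on the line of [e], both differences are compared with the one for a [u]
    outside the span of [e], [x], [z]; this uses the fourth dimension. *)
Lemma f_diff x z w : ~ exts L x z -> ~ exts L x w -> f (x + z) - f z = f (x + w) - f w.
Proof.
move=> hz hw; have [h|] := pselect (L (x + z + w)); last exact: f_diff_step.
have [u nu] := avoid x z.
have hw' : exts (exts L x) z w.
  rewrite -(addKr (x + z) w) addrC; apply: subB; first exact/ext_les/ext_les.
  by apply: subD; [apply/ext_les/ext_self|apply: ext_self].
have hu : ~ exts L x u by move=> h'; apply/nu/ext_les.
have shift v : exts (exts L x) z v -> ~ L (x + v + u).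
  move=> hv hL; apply: nu; rewrite -(addKr (x + v) u) addrC.
  by apply: subB; [apply/ext_les/ext_les|apply: subD => //; apply/ext_les/ext_self].
rewrite (f_diff_step hz hu); last by apply: shift; apply: ext_self.
by rewrite (f_diff_step hw hu) //; apply: shift.
Qed.

(** The normalisation controls [f] only off the line of [e]. The difference, which does not depend
    on [z] by [f_diff], extends it to all of [V]. *)
Variable g : V -> V'.
Hypothesis gP : forall x z, ~ exts L x z -> g x = f (x + z) - f z.

Lemma g_add x y : g (x + y) = g x + g y.
Proof.
have [z hz] := avoid x y.
have sub w : exts (exts L x) y w -> ~ exts L w z.
  move=> hw h; apply: hz; apply: (ext_leP _ hw) h.
  by apply: (les_trans (@ext_les _ _ L x)); apply: ext_les.
have hx : exts (exts L x) y x by apply/ext_les/ext_self.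
have hy : exts (exts L x) y y by apply: ext_self.
rewrite (gP (sub _ (subD hx hy))) (gP (sub _ hy)).
rewrite (@gP x (y + z)) ?addrA ?subrK // => h; apply: hz.
by rewrite -(addKr y z) addrC; apply: subB => //; apply: ext_les.
Qed.

Lemma g_off x : ~ L x -> g x = f x.
Proof.
move=> nx; have [z hz] := avoid1 x.
by rewrite (gP hz) f_free ?addrK.
Qed.

(** For [x] on the line of [e], [g x] lies in [sums (Q e) (Q z)] for every [z] off that line. Two
    such sums, with [e], [z], [w] independent, meet only in [Q e]. *)
Lemma g_Q x : x <> 0 -> Q x (g x).
Proof.
move=> x0; have [Lx|nx] := pselect (L x); last by rewrite g_off //; case: (fP nx).
have [-> |/eqP gx0] := eqVneq (g x) 0; first exact: sub0.
have mem z : ~ L z -> sums (Q e) (Q z) (g x).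
  move=> nz; have nxz : ~ L (x + z) by apply: nline_shift.
  have hz : ~ exts L x z.
    by move=> h; apply: nz; apply: (ext_leP _ Lx) h.
  rewrite (gP hz); apply: subB; last by apply: sumr; case: (fP nz).
  have h : les (Q (x + z)) (sums (Q e) (Q z)).
    apply/Q_span => //; try exact: nline_neq0.
    by apply: subD; [apply: suml|apply: span2r].
  by apply: h; case: (fP nxz).
have [z hz] := avoid1 e; have [w hw] := avoid1 z.
have nz := nexts_nline hz; have nw := nexts_nline hw.
have [||||||| u [u0 Qu hu /span2P[c [d eu]]]] :=
  @Q_meet e z e w (g x) => //; try exact: nline_neq0; try exact: mem.
have {}hu : L u.
  have [d0|d0] := eqVneq d 0; first by exists c; rewrite eu d0 scale0r addr0.
  case: hw; apply: (subZ_inv hK d0); rewrite -(addKr (c *: e) (d *: w)) -eu addrC.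
  by apply: subB => //; apply/ext_les/subZ/line_self.
have Qeg : Q e (g x) by apply: (Q_mono e_neq0 u0 hu).
by apply: (Q_mono x0 e_neq0 (lines_swap x0 Lx)).
Qed.

Lemma g_neq0 x : x <> 0 -> g x <> 0.
Proof.
move=> x0; have [Lx|nx] := pselect (L x); last first.
  by rewrite g_off //; apply: (lift_neq0 nx); apply: fP.
have [z nz] := avoid1 e; have hz : ~ exts L x z.
  by move=> h; apply: nz; apply/ext_les; apply: (ext_leP _ Lx) h.
rewrite (gP hz) => /eqP; rewrite subr_eq0 => /eqP exz.
have nLz := nexts_nline hz; have nxz : ~ L (x + z) by apply: nline_shift.
have v0 := lift_neq0 nLz (fP nLz).
have [Qz _] := fP nLz; have [Qxz _] := fP nxz; rewrite exz in Qxz.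
have h := Q_meet1 (nline_neq0 nLz) (nline_neq0 nxz) v0 Qz Qxz.
apply: nLz; have zx : lines z x.
  by rewrite -[x](addrK z); apply: subB => //; apply: line_self.
by apply: (line_les Lx); apply: lines_swap.
Qed.

End Frame.

Lemma additive_lift : exists g : V -> V', [/\ forall x y, g (x + y) = g x + g y,
  forall x, x <> 0 -> Q x (g x) & forall x, x <> 0 -> g x <> 0].
Proof.
have [e he] := dim_ge4 0 0 0.
have e0 : e <> 0 by move=> e0; apply: he; rewrite e0; apply: sub0.
have [e' [e'0 Qe]] := Q_line e0.
have [x|f fP] := @choice _ _ (fun x x' => ~ lines e x -> lift e e' x x').
  have [h|h] := pselect (lines e x); first by exists 0.
  by have [x' hx'] := lift_exists e0 Qe h; exists x'.
have [z hz] := choice (avoid1 e).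
pose g x := f (x + z x) - f (z x).
have gP x w : ~ exts (lines e) x w -> g x = f (x + w) - f w.
  move=> hw; exact: (f_diff e0 Qe fP (hz x) hw).
exists g; split.
- exact: (g_add gP).
- exact: (g_Q e0 Qe fP gP).
- exact: (g_neq0 e0 e'0 Qe fP gP).
Qed.

(** Since points go to points, [g (a *: x)] is a multiple of [g x]. Comparing [x], [y] and [x + y]
    for independent [x], [y] shows that the factor does not depend on the vector; dependent vectors
    are compared through a third one. *)
Lemma additive_lift_semilinear (g : V -> V') :
  (forall x y, g (x + y) = g x + g y) -> (forall x, x <> 0 -> Q x (g x)) ->
  (forall x, x <> 0 -> g x <> 0) ->
  exists s, ring_iso s /\ semilinear_bij s g.
Proof.
move=> gD gQ g0.
have g00 : g 0 = 0 by apply: (addrI (g 0)); rewrite -gD !addr0.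
have gN x : g (- x) = - g x by apply: (addrI (g x)); rewrite -gD !subrr.
have ex a x : x <> 0 -> exists b, g (a *: x) = b *: g x.
  move=> x0; have [e|/eqP ax0] := eqVneq (a *: x) 0.
    by exists 0; rewrite e g00 scale0r.
  have: Q x (g (a *: x)) by apply: (Q_mono x0 ax0); [exists a|apply: gQ].
  by rewrite (Q_eq_line x0 (g0 _ x0) (gQ _ x0)).
have g_ind x y b c : x <> 0 -> ~ lines x y -> b *: g x = c *: g y -> b = 0 /\ c = 0.
  move=> x0 nxy e; have y0 : y <> 0 by move=> y0; apply: nxy; rewrite y0; apply: sub0.
  have gx0 := g0 x x0; have gy0 := g0 y y0.
  have c0 : c = 0.
    apply: contrapT => /eqP c0; apply: nxy.
    apply: (Q_meet1 x0 y0 gy0); last exact: gQ.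
    by apply: (subZ_inv hK' c0); rewrite -e; apply/subZ/gQ.
  by split=> //; apply: (scale_eq0 hK' _ gx0); rewrite e c0 scale0r.
have same a b x y : x <> 0 -> ~ lines x y -> g (a *: x) = b *: g x -> g (a *: y) = b *: g y.
  move=> x0 nxy ebx; have y0 : y <> 0 by move=> y0; apply: nxy; rewrite y0; apply: sub0.
  have xy0 : x + y <> 0.
    by move=> h; apply: nxy; rewrite -[y](addKr x) h addr0; apply/subN/line_self.
  have [c ecy] := ex a y y0; have [d ed] := ex a (x + y) xy0.
  move: ed; rewrite scalerDr !gD ebx ecy scalerDr => E.
  have [] := g_ind x y (d - b) (c - d) x0 nxy.
    by apply/eqP; rewrite !scalerBl subr_eq addrAC eq_sym subr_eq addrC E.
  by move=> /eqP; rewrite subr_eq0 => /eqP -> /eqP; rewrite subr_eq0 => /eqP <-.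
have [x0 hx0] := dim_ge4 0 0 0.
have x0n : x0 <> 0 by move=> e; apply: hx0; rewrite e; apply: sub0.
have [w0 hw0] := dim_ge4 x0 0 0.
have nw0 : ~ lines x0 w0 by move=> h; apply: hw0; apply/ext_les/suml.
have w0n : w0 <> 0 by move=> e; apply: nw0; rewrite e; apply: sub0.
have [s hs0] := choice (fun a => ex a x0 x0n).
have hs a x : g (a *: x) = s a *: g x.
  have [-> |/eqP xn] := eqVneq x 0; first by rewrite scaler0 g00 scaler0.
  have [h|h] := pselect (lines x0 x); last exact: same (hs0 a).
  apply: (@same a (s a) w0 x) => //; last exact: same (hs0 a).
  by move=> h'; apply/nw0/(line_les h)/lines_swap.
have cancel_gx0 b c : b *: g x0 = c *: g x0 -> b = c.
  move=> /eqP; rewrite -subr_eq0 -scalerBl => /eqP h.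
  by apply/eqP; rewrite -subr_eq0; apply/eqP; apply: (scale_eq0 hK' h); apply: g0.
have s_inj : injective s.
  move=> a b e; apply/eqP; rewrite -subr_eq0; apply/eqP.
  apply: (scale_eq0 hK _ x0n); apply: contrapT => /g0; apply.
  by rewrite scalerBl gD gN !hs e subrr.
have sD a b : s (a + b) = s a + s b.
  by apply: cancel_gx0; rewrite -hs scalerDl gD !hs scalerDl.
have sM a b : s (a * b) = s a * s b.
  by apply: cancel_gx0; rewrite -hs -scalerA !hs scalerA.
have s1 : s 1 = 1 by apply: cancel_gx0; rewrite -hs !scale1r.
have s0 : s 0 = 0 by apply: cancel_gx0; rewrite -hs !scale0r.
have s_surj b : exists a, s a = b.
  have v0 : b *: g x0 + g w0 <> 0.
    move=> h; have [|_ /eqP] := g_ind x0 w0 b (-1) x0n nw0.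
      by rewrite scaleN1r; apply/eqP; rewrite -addr_eq0 h.
    by rewrite oppr_eq0 oner_eq0.
  (* The point of [b *: g x0 + g w0] comes from some [u = c *: x0 + d *: w0]; the coordinate ratio
     [d^-1 * c] is the preimage of [b]. *)
  have [u [u0 Qu]] := Q_surj v0.
  have /span2P[c [d eu]] : span2 x0 w0 u.
    apply/Q_span => //; rewrite (Q_eq_line u0 v0 Qu); apply: line_les.
    by exists (b *: g x0), (g w0); split=> //; [apply/subZ/gQ|apply: gQ].
  move: Qu; rewrite (Q_eq_line u0 (g0 _ u0) (gQ _ u0)) => -[t].
  rewrite eu gD !hs scalerDr !scalerA => E.
  have [] := g_ind x0 w0 (b - t * s c) (t * s d - 1) x0n nw0.
    by apply/eqP; rewrite !scalerBl scale1r subr_eq addrAC eq_sym subr_eq E addrC.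
  move=> /eqP; rewrite subr_eq0 => /eqP -> /eqP; rewrite subr_eq0 => /eqP etd.
  have d0 : d != 0.
    by apply/eqP => d0; move: etd; rewrite d0 s0 mulr0 => /esym/eqP; rewrite oner_eq0.
  have et : t = s d^-1.
    by rewrite -[t]mulr1 -s1 -(mulrV (hK d0)) sM mulrA etd mul1r.
  by exists (d^-1 * c); rewrite sM et.
exists s; split; first by split=> //; apply: inj_surj_bijective.
split=> //; apply: inj_surj_bijective.
  move=> x y e; apply/eqP; rewrite -subr_eq0; apply/eqP; apply: contrapT => /g0; apply.
  by rewrite gD gN e subrr.
move=> v; have [-> |/eqP v0] := eqVneq v 0; first by exists 0.
have [x [xn Qx]] := Q_surj v0.
move: Qx; rewrite (Q_eq_line xn (g0 _ xn) (gQ _ xn)) => -[b ->].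
by have [a <-] := s_surj b; exists (a *: x).
Qed.

Theorem fundamental_theorem : exists s g,
  [/\ ring_iso s, @semilinear_bij K K' V V' s g & forall x, x <> 0 -> Q x (g x)].
Proof.
have [g [gD gQ g0]] := additive_lift.
by have [s [si sg]] := additive_lift_semilinear gD gQ g0; exists s, g.
Qed.

End FundamentalTheorem.

(** * Stars and tops *)

Section AdjacentTriples.
Variables (K : unitRingType) (V : lmodType K).
Hypothesis hK : division_ring K.
Implicit Types (A B X Y Z W : sub V).

Lemma cap_rot X Y Z : adj X Y -> adj X Z -> les (caps X Y) Z -> caps X Z = caps X Y.
Proof.
move=> [cXY _] [cXZ _] lZ.
have lc : les (caps X Y) (caps X Z) by apply: les_cap => //; apply: capl.
by case: (cov_between hK cXY lc (@capl _ _ X Z)) => // e; case: (cov_neq cXZ).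
Qed.

Lemma les_cap_rot X Y Z : adj X Y -> adj X Z -> les (caps X Y) Z -> les (caps X Z) Y.
Proof. by move=> a1 a2 h; rewrite (cap_rot a1 a2 h); apply: capr. Qed.

Lemma cov_meet A X Y : cov A X -> cov A Y -> X <> Y -> caps X Y = A /\ adj X Y.
Proof.
move=> cX cY n; suff e : caps X Y = A by split=> //; split; rewrite e.
have l : les A (caps X Y) by apply: les_cap; apply: cov_les.
case: (cov_between hK cX l (@capl _ _ X Y)) => // e.
have lXY : les X Y by rewrite -e; apply: capr.
by case: (cov_between hK cY (cov_les cX) lXY) => // e'; case: (cov_neq cX).
Qed.

Lemma cov_join B X Y : cov X B -> cov Y B -> X <> Y -> sums X Y = B /\ adj X Y.
Proof.
move=> cX cY n; suff e : sums X Y = B by split=> //; apply: adj_sums => //; rewrite e.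
have l : les (sums X Y) B by apply: sum_les; apply: cov_les.
case: (cov_between hK cX (@suml _ _ X Y) l) => // e.
have lYX : les Y X by rewrite -e; apply: sumr.
by case: (cov_between hK cY lYX (cov_les cX)) => // e'; case: (cov_neq cX).
Qed.

(** If [caps X Z] and [caps Y Z] agree, they coincide with [caps X Y]; otherwise these two
    hyperplanes of [Z] span it inside [sums X Y]. *)
Lemma adj_triple X Y Z : adj X Y -> adj X Z -> adj Y Z ->
  les (caps X Y) Z \/ les Z (sums X Y).
Proof.
move=> aXY aXZ aYZ; have [cXY _] := aXY; have [cXZ cZX] := aXZ; have [_ cZY] := aYZ.
have [e|n] := pselect (caps X Z = caps Y Z).
  left; have l : les (caps X Z) (caps X Y).
    by apply: les_cap; [apply: capl|rewrite e; apply: capl].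
  case: (cov_between hK cXZ l (@capl _ _ X Y)) => e'; last by case: (cov_neq cXY).
  by rewrite e'; apply: capr.
right; have [<- _] := cov_join cZX cZY n.
by apply: sum_les; [apply: les_trans (@suml _ _ X Y)|apply: les_trans (@sumr _ _ X Y)];
  apply: capl.
Qed.

Definition tri X Y Z := [/\ adj X Y, adj X Z, adj Y Z & ~ pencil X Y Z].

Lemma tri_rot X Y Z : tri X Y Z -> tri X Z Y.
Proof. by move=> [a1 a2 a3 n]; split=> //; [apply: adj_sym|move=> /(pencil_rot hK)]. Qed.

Lemma tri_sym X Y Z : tri X Y Z -> tri Y X Z.
Proof. by move=> [a1 a2 a3 n]; split=> //; [apply: adj_sym|move=> /pencil_sym]. Qed.

Lemma tri_top X Y Z : tri X Y Z -> ~ les (caps X Y) Z -> les Z (sums X Y).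
Proof. by move=> [a1 a2 a3 _] h; case: (adj_triple a1 a2 a3). Qed.

Lemma tri_star X Y Z : tri X Y Z -> les (caps X Y) Z -> ~ les Z (sums X Y).
Proof. by move=> [a1 a2 a3 n] h1 h2; apply: n. Qed.

Lemma star_cov X Y Z : tri X Y Z -> les (caps X Y) Z -> cov (caps X Y) Z.
Proof. by move=> [a1 a2 _ _] h; rewrite -(cap_rot a1 a2 h); case: a2. Qed.

Lemma top_cov X Y Z : tri X Y Z -> les Z (sums X Y) -> cov Z (sums X Y).
Proof.
move=> [a1 a2 _ _] h.
have c1 := adj_cov_suml hK a1; have c2 := adj_cov_suml hK a2.
have l : les (sums X Z) (sums X Y) by apply: sum_les => //; apply: suml.
case: (cov_between hK c1 (@suml _ _ X Z) l) => e; first by case: (cov_neq c2).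
by rewrite -e; apply: adj_cov_sumr.
Qed.

(* Hence a map preserving adjacency both ways keeps, or exchanges, stars and tops over a
   fixed adjacent pair. *)
Lemma tri_same_kind X Y Z W : tri X Y Z -> tri X Y W ->
  ((les (caps X Y) Z <-> les (caps X Y) W) <-> (Z = W \/ adj Z W)).
Proof.
(* A star vertex [Z'] meets [sums X Y] in [caps X Y] only, hence meets a top vertex [W'] inside
   [caps X Y]. If they were adjacent, [caps Z' W'] would be all of [caps X Y], which would then lie
   in [W']. *)
have key Z' W' : tri X Y Z' -> tri X Y W' -> les (caps X Y) Z' -> ~ les (caps X Y) W' ->
    ~ (Z' = W' \/ adj Z' W').
  move=> tZ tW sZ sW [e|[c1 _]]; first by apply: sW; rewrite -e.
  have tWB := tri_top tW sW; have cZ := star_cov tZ sZ; apply: sW.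
  have e : caps Z' (sums X Y) = caps X Y.
    have l : les (caps X Y) (caps Z' (sums X Y)).
      by apply: les_cap => //; apply: (les_trans (@capl _ _ X Y)); apply: suml.
    case: (cov_between hK cZ l (@capl _ _ _ _)) => // e.
    by case: (tri_star tZ sZ); rewrite -e; apply: capr.
  have l : les (caps Z' W') (caps X Y).
    by rewrite -e; apply: les_cap; [apply: capl|apply: (les_trans (@capr _ _ _ _))].
  case: (cov_between hK c1 l (cov_les cZ)) => e'; first by rewrite e'; apply: capr.
  by case: (cov_neq cZ).
move=> tZ tW; split=> [h|h]; last first.
  have [sZ|sZ] := pselect (les (caps X Y) Z); have [sW|sW] := pselect (les (caps X Y) W) => //.
    by case: (key _ _ tZ tW sZ sW).
  by case: (key _ _ tW tZ sW sZ); case: h => [->|/adj_sym]; [left|right].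
have [e|n] := pselect (Z = W); [by left|right].
have [sZ|sZ] := pselect (les (caps X Y) Z).
  by have [_ a] := cov_meet (star_cov tZ sZ) (star_cov tW (h.1 sZ)) n.
have sW : ~ les (caps X Y) W by move=> /h.
by have [_ a] := cov_join (top_cov tZ (tri_top tZ sZ)) (top_cov tW (tri_top tW sW)) n.
Qed.

Hypothesis hfin : findim (fulls V).


(** As [m.+1 < 2 * m], some vector lies outside [sums X Y]; adjoining it to [caps X Y] gives [Z]. *)
Lemma exists_star m X Y : dims (fulls V) = (2 * m)%N -> (2 <= m)%N -> dims X = m ->
  adj X Y -> exists Z, [/\ tri X Y Z, les (caps X Y) Z & dims Z = m].
Proof.
move=> dV m2 dX a; have c := adj_cov_suml hK a.
have [|v [_ nv]] := @dims_outside _ _ hK hfin (sums X Y) (fulls V).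
  by rewrite (dims_cov hK hfin c) dV dX; lia.
have nA : ~ caps X Y v by move=> [Xv _]; apply/nv/suml.
pose Z := exts (caps X Y) v; have cZ : cov (caps X Y) Z by apply: cov_ext.
have Zv : Z v by apply: ext_self.
have [_ aXZ] : caps X Z = caps X Y /\ adj X Z.
  by apply: cov_meet => //; [case: a|move=> e; apply/nv/suml; rewrite e].
have [_ aYZ] : caps Y Z = caps X Y /\ adj Y Z.
  by apply: cov_meet => //; [case: a|move=> e; apply/nv/sumr; rewrite e].
exists Z; split; [split=> //|exact: cov_les|].
  by move=> [_ _ _ _ h]; apply/nv/h.
by rewrite (dims_cov hK hfin cZ) -(dims_cov hK hfin a.1).
Qed.

End AdjacentTriples.

Section TwoKinds.
Variables (K K' : unitRingType) (hK : division_ring K) (hK' : division_ring K').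
Variables (V : lmodType K) (V' : lmodType K') (m : nat).
Hypotheses (hfin : findim (fulls V)) (dV : dims (fulls V) = (2 * m)%N) (m2 : (2 <= m)%N).
Hypothesis GE : forall X : sub V, inG X <-> dims X = m.
Variables (Phi : sub V -> sub V') (Psi : sub V' -> sub V).
Hypothesis iso : compl_iso Phi Psi.
Implicit Types (X Y Z W : sub V).

Lemma compl_iso_adjE X Y : inG X -> inG Y -> (adj X Y <-> adj (Phi X) (Phi Y)).
Proof.
have [h1 h2 h3 h4 _] := iso => GX GY; split; first exact: (compl_iso_adj hK hK' iso GX GY).
by move=> /(compl_iso_adj hK' hK (compl_iso_sym iso) (h1 _ GX) (h1 _ GY)); rewrite !h3.
Qed.

Lemma compl_iso_pencilE X Y Z : inG X -> inG Y -> inG Z ->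
  (pencil X Y Z <-> pencil (Phi X) (Phi Y) (Phi Z)).
Proof.
have [h1 h2 h3 h4 _] := iso => GX GY GZ; split.
  exact: (compl_iso_pencil hK hK' iso GX GY GZ).
move=> /(compl_iso_pencil hK' hK (compl_iso_sym iso) (h1 _ GX) (h1 _ GY) (h1 _ GZ)).
by rewrite !h3.
Qed.

Lemma compl_iso_tri X Y Z : inG X -> inG Y -> inG Z ->
  tri X Y Z -> tri (Phi X) (Phi Y) (Phi Z).
Proof.
move=> GX GY GZ [a1 a2 a3 n]; split; try exact/compl_iso_adjE.
by move=> /compl_iso_pencilE h; apply/n/h.
Qed.

Lemma tri_G X Y Z : inG X -> tri X Y Z -> inG Y /\ inG Z.
Proof. by move=> GX [a1 a2 _ _]; split; apply: (inG_adj hK _ GX). Qed.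

Definition keeps_kind X Y Z :=
  les (caps X Y) Z <-> les (caps (Phi X) (Phi Y)) (Phi Z).

Definition keeps_kinds X Y := forall Z, tri X Y Z -> keeps_kind X Y Z.

(** By [tri_same_kind], agreement of kinds over an edge amounts to equality or adjacency of third
    vertices, which [Phi] respects in both directions. One test triangle therefore decides. *)
Lemma keeps_kind_all X Y Z : inG X -> tri X Y Z -> keeps_kind X Y Z -> keeps_kinds X Y.
Proof.
move=> GX tZ kZ W tW; have [GY GZ] := tri_G GX tZ; have [_ GW] := tri_G GX tW.
have h1 := tri_same_kind hK tZ tW.
have h2 := tri_same_kind hK' (compl_iso_tri GX GY GZ tZ) (compl_iso_tri GX GY GW tW).
have h3 : (Z = W \/ adj Z W) <-> (Phi Z = Phi W \/ adj (Phi Z) (Phi W)).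
  split=> -[e|a]; [by rewrite e; left|by right; apply/compl_iso_adjE|left|right].
    exact: (compl_iso_inj iso GZ GW e).
  exact/compl_iso_adjE.
rewrite /keeps_kind in kZ *.
have [cW|cW] := pselect (les (caps X Y) W);
  have [cW'|cW'] := pselect (les (caps (Phi X) (Phi Y)) (Phi W)); tauto.
Qed.

Lemma keeps_kinds_sym X Y : keeps_kinds X Y -> keeps_kinds Y X.
Proof.
move=> k Z /(tri_sym) /k; rewrite /keeps_kind capC [caps (Phi X) _]capC; exact.
Qed.

Lemma keeps_kinds_tri X Y Z : inG X -> tri X Y Z -> keeps_kinds X Y -> keeps_kinds X Z.
Proof.
move=> GX t k; have kZ := k Z t; have [GY GZ] := tri_G GX t.
apply: (keeps_kind_all GX (tri_rot hK t)); rewrite /keeps_kind in kZ *.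
have [a1 a2 a3 _] := t; have [b1 b2 b3 _] := compl_iso_tri GX GY GZ t.
by split=> h; [apply: (les_cap_rot hK' b1 b2); apply/kZ; apply: (les_cap_rot hK a2 a1)
  |apply: (les_cap_rot hK a1 a2); apply/kZ; apply: (les_cap_rot hK' b2 b1)].
Qed.

(** If the three form a pencil, the step goes through a star vertex [W] outside [sums X Y]: together
    with [X] it completes both [Y] and [Z] to triangles outside pencils. *)
Lemma keeps_kinds_clique X Y Z : inG X -> adj X Y -> adj X Z -> adj Y Z ->
  keeps_kinds X Y -> keeps_kinds X Z.
Proof.
move=> GX a1 a2 a3 k; have [p|n] := pselect (pencil X Y Z); last first.
  by apply: (@keeps_kinds_tri X Y Z).
have [W [tW sW _]] := exists_star hK hfin dV m2 ((GE X).1 GX) a1.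
have nW := tri_star tW sW; have [_ aXW _ _] := tW.
have eXZ := pencil_cap hK p; have esXZ := pencil_sum hK p.
have cZ : cov (caps X Y) Z by rewrite -eXZ; case: a2.
have nZW : Z <> W by move=> e; apply: nW; rewrite -e; case: p.
have [_ aZW] := cov_meet hK cZ (star_cov hK tW sW) nZW.
have tZ : tri X Z W.
  by split=> // -[_ _ _ _]; rewrite esXZ.
by apply: (keeps_kinds_tri GX (tri_rot hK tZ)); apply: keeps_kinds_tri tW k.
Qed.

(** Arbitrary neighbours [Y] and [Z] of [X] are linked by [W], spanned by [caps X Y] and a vector of
    [Z] outside [X]: it shares the hyperplane [caps X Y] with [X] and [Y], and it is a hyperplane of
    [sums X Z]. *)
Lemma keeps_kinds_star X Y Z : inG X -> adj X Y -> adj X Z ->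
  keeps_kinds X Y -> keeps_kinds X Z.
Proof.
move=> GX aXY aXZ k.
have cXB := adj_cov_suml hK aXZ; have cZB := adj_cov_sumr hK aXZ.
have [v [Zv nXv]] : exists v, Z v /\ ~ X v.
  have [v [Zv nv]] := neq_sub (cov_les aXZ.2) (cov_neq aXZ.2).
  by exists v; split=> // Xv; apply: nv.
pose W := exts (caps X Y) v; have Wv : W v by apply: ext_self.
have cW : cov (caps X Y) W by apply: cov_ext => -[].
have nXW : X <> W by move=> e; apply: nXv; rewrite e.
have [_ aXW] := cov_meet hK aXY.1 cW nXW.
have kW : keeps_kinds X W.
  have [e|n] := pselect (Y = W); first by rewrite -e.
  have [_ aYW] := cov_meet hK aXY.2 cW n.
  exact: (keeps_kinds_clique GX aXY aXW aYW k).
have [e|n] := pselect (W = Z); first by rewrite -e.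
have cWB : cov W (sums X Z).
  apply: cov_dims => //.
    apply: ext_leP; last exact: sumr.
    by apply: (les_trans (@capl _ _ X Y)); apply: suml.
  by rewrite (dims_cov hK hfin cXB) (dims_cov hK hfin cW) -(dims_cov hK hfin aXY.1).
have [_ aWZ] := cov_join hK cWB cZB n.
exact: (keeps_kinds_clique GX aXW aXZ aWZ kW).
Qed.

Lemma keeps_kinds_everywhere X Y Z W : inG X -> inG Z -> adj X Y -> adj Z W ->
  keeps_kinds X Y -> keeps_kinds Z W.
Proof.
move=> GX GZ aXY aZW k.
have dX := (GE X).1 GX; have dZ := (GE Z).1 GZ.
have [||l _ p] := @adj_path_exists _ _ hK hfin m X Z; [by rewrite dX dZ|by lia|].
elim: l X Y GX aXY k p {dX} => [|l IH] X Y GX aXY k /=.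
  by move=> e; rewrite e in GX aXY k; apply: keeps_kinds_star aXY aZW k.
move=> [U [aXU p]]; apply: (IH U X (inG_adj hK aXU GX) (adj_sym aXU)) => //.
exact/keeps_kinds_sym/(keeps_kinds_star GX aXY aXU).
Qed.

(** Pencils are included: [Phi] preserves them anyway, and three covers of one subspace can then be
    treated uniformly. *)
Definition collineation := forall X Y Z, inG X -> adj X Y -> adj X Z -> adj Y Z ->
  keeps_kind X Y Z.

Lemma keeps_kinds_collineation X Y : inG X -> adj X Y -> keeps_kinds X Y -> collineation.
Proof.
move=> GX aXY k U W Z GU aUW aUZ aWZ.
have GW := inG_adj hK aUW GU; have GZ := inG_adj hK aUZ GU.
have [p|n] := pselect (pencil U W Z); last first.
  by apply: (keeps_kinds_everywhere GX GU aXY aUW k).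
have [_ _ _ h1 _] := p; have [_ _ _ h2 _] := (compl_iso_pencilE GU GW GZ).1 p.
by split.
Qed.

End TwoKinds.

(** * Chow's theorem *)

(** The candidate image of a small subspace. It is controlled only up to dimension [m], where [A] is
    an intersection of members of [inG]. *)
Definition meet_image (K K' : unitRingType) (V : lmodType K) (V' : lmodType K')
    (Phi : sub V -> sub V') (A : sub V) : sub V' :=
  bigcaps (fun X' => exists X : sub V, [/\ inG X, les A X & X' = Phi X]).

(** * One step of the descent in dimension *)

Section Descent.
Variables (K K' : unitRingType) (hK : division_ring K) (hK' : division_ring K').
Variables (V : lmodType K) (V' : lmodType K') (m : nat).
Hypotheses (hfin : findim (fulls V)) (dV : dims (fulls V) = (2 * m)%N).
Hypothesis hfin' : findim (fulls V').
Hypothesis GE : forall X : sub V, inG X <-> dims X = m.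
Variables (Phi : sub V -> sub V') (Psi : sub V' -> sub V).
Hypothesis iso : compl_iso Phi Psi.
Hypothesis col : collineation Phi.
Implicit Types (A B X Y Z W : sub V).

Local Notation F := (meet_image Phi).
Local Notation F' := (meet_image Psi).

Lemma meet_image_mono A B : les A B -> les (F A) (F B).
Proof. by move=> l v h _ [X [GX lX ->]]; apply: h; exists X; split=> //; apply: les_trans lX. Qed.

Lemma meet_image_les A X : inG X -> les A X -> les (F A) (Phi X).
Proof. by move=> GX l v; apply; exists X. Qed.

Lemma meet_image_G X : inG X -> F X = Phi X.
Proof.
move=> GX; apply: sub_ext; first exact: meet_image_les.
move=> v Xv _ [Y [GY l ->]]; rewrite -(@dims_les_eq _ _ hK hfin X Y) //.
by rewrite (GE X).1 // (GE Y).1.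
Qed.

(** A complement of [lines v] containing [A] is a hyperplane missing [v], and its dimension
    [2 * m - 1] leaves room for an intermediate [X]. *)
Lemma exists_avoiding A v : (dims A <= m)%N -> ~ A v -> exists X, [/\ inG X, les A X & ~ X v].
Proof.
move=> dA nAv; have [w Aw Lw|H [lAH dH]] := @complement_above _ _ hK A (lines v).
  exact: (not_line hK nAv Aw Lw).
have v0 : v <> 0 by move=> e; apply: nAv; rewrite e; apply: sub0.
have nHv : ~ H v by move=> Hv; apply/v0/(dH.1 v Hv)/line_self.
have := direct_sum_dims hK hfin dH; rewrite dims_line // dV => e.
have m0 : (m <= dims H)%N.
  have := dims_les hK hfin (@lesT _ _ (exts A v)); rewrite dims_ext // dV; lia.
have [X [lAX lXH dX]] := interpolate hK hfin lAH dA m0.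
by exists X; split; [apply/GE| |move=> /lXH].
Qed.

Lemma meet_imageK_les A : (dims A <= m)%N -> les (F' (F A)) A.
Proof.
move=> dA v h; apply: contrapT => nAv; have [X [GX lX]] := exists_avoiding dA nAv.
have [h1 _ h3 _ _] := iso; apply; rewrite -(h3 X GX); apply: h.
by exists (Phi X); split=> //; [apply: h1|apply: meet_image_les].
Qed.

Section Level.
Variable k : nat.
(** The induction hypothesis concerns both directions, since injectivity of [F] above level [k] is
    obtained by applying [F']. *)
Hypothesis dF : forall A, (k < dims A <= m)%N -> dims (F A) = dims A.
Hypothesis dF' : forall A : sub V', (k < dims A <= m)%N -> dims (F' A) = dims A.

Lemma meet_imageK A : (k < dims A <= m)%N -> F' (F A) = A.
Proof.
move=> d; apply: dims_les_eq => //; first by apply: meet_imageK_les; case/andP: d.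
by rewrite dF' ?dF.
Qed.

Lemma meet_image_inj A B : (k < dims A <= m)%N -> (k < dims B <= m)%N ->
  F A = F B -> A = B.
Proof. by move=> dA dB e; rewrite -(meet_imageK dA) e meet_imageK. Qed.

Lemma meet_image_reflect A B : (k < dims A <= m)%N -> (k < dims B <= m)%N ->
  les (F A) (F B) -> les A B.
Proof.
move=> dA dB l; rewrite -(meet_imageK dA) -(meet_imageK dB) => v h _ [X [GX lX ->]].
by apply: h; exists X; split=> //; apply: les_trans lX.
Qed.

Variable A : sub V.
Hypotheses (dA : dims A = k) (km : (k < m)%N).

Lemma cov_dimsA B : cov A B -> dims B = k.+1.
Proof. by move=> /(dims_cov hK hfin) ->; rewrite dA. Qed.

Lemma meet_image_join A1 A2 : (k.+1 < m)%N -> cov A A1 -> cov A A2 -> A1 <> A2 ->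
  sums (F A1) (F A2) = F (sums A1 A2) /\ adj (F A1) (F A2).
Proof.
move=> km' c1 c2 n; have [_ a12] := cov_meet hK c1 c2 n.
have d1 := cov_dimsA c1; have d2 := cov_dimsA c2.
have d12 := dims_cov hK hfin (adj_cov_suml hK a12).
apply: (cov_join hK').
- apply: cov_dims => //; first by apply: meet_image_mono; apply: suml.
  by rewrite !dF ?d12 ?d1 //; lia.
- apply: cov_dims => //; first by apply: meet_image_mono; apply: sumr.
  by rewrite !dF ?d12 ?d1 ?d2 //; lia.
- by move=> /meet_image_inj e; apply/n/e; lia.
Qed.

Lemma meet_image_adj A1 A2 : cov A A1 -> cov A A2 -> A1 <> A2 -> adj (F A1) (F A2).
Proof.
move=> c1 c2 n; have [_ a12] := cov_meet hK c1 c2 n.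
have [lt|ge] := ltnP k.+1 m; first by have [] := meet_image_join lt c1 c2 n.
have GA B : cov A B -> inG B by move=> /cov_dimsA d; apply/GE; rewrite d; lia.
rewrite !meet_image_G; try exact: GA.
by apply/(compl_iso_adj hK hK' iso) => //; apply: GA.
Qed.

(** By [adj_triple] the alternative puts [F A3] into [F (sums A1 A2)], which reflects to an excluded
    inclusion. The bound [k.+1 < m] keeps that sum within the induction hypothesis. *)
Lemma meet_image_star_nonplanar A1 A2 A3 : (k.+1 < m)%N ->
  cov A A1 -> cov A A2 -> cov A A3 -> A1 <> A2 -> ~ les A3 (sums A1 A2) ->
  les (caps (F A1) (F A2)) (F A3).
Proof.
move=> km' c1 c2 c3 n12 n3.
have n13 : A1 <> A3 by move=> e; apply: n3; rewrite -e; apply: suml.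
have n23 : A2 <> A3 by move=> e; apply: n3; rewrite -e; apply: sumr.
have [_ a12] := cov_meet hK c1 c2 n12.
have d12 := dims_cov hK hfin (adj_cov_suml hK a12).
have d1 := cov_dimsA c1; have d3 := cov_dimsA c3.
have [e12 b12] := meet_image_join km' c1 c2 n12.
have b13 := meet_image_adj c1 c3 n13; have b23 := meet_image_adj c2 c3 n23.
have [//|] := adj_triple hK' b12 b13 b23; rewrite e12 => h.
by case: n3; apply: meet_image_reflect h; lia.
Qed.

Lemma meet_image_star A1 A2 A3 : cov A A1 -> cov A A2 -> cov A A3 -> A1 <> A2 ->
  les (caps (F A1) (F A2)) (F A3).
Proof.
move=> c1 c2 c3 n12.
have [<-|n13] := pselect (A1 = A3); first exact: capl.
have [<-|n23] := pselect (A2 = A3); first exact: capr.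
have [e12 a12] := cov_meet hK c1 c2 n12; have [_ a13] := cov_meet hK c1 c3 n13.
have [_ a23] := cov_meet hK c2 c3 n23.
have [lt|ge] := ltnP k.+1 m; last first.
  have GA B : cov A B -> inG B by move=> /cov_dimsA d; apply/GE; rewrite d; lia.
  rewrite !meet_image_G; try exact: GA.
  apply/(col (GA _ c1) a12 a13 a23); rewrite e12; exact: cov_les.
have [l3|] := pselect (les A3 (sums A1 A2)); last exact: meet_image_star_nonplanar.
have cB := adj_cov_suml hK a12; have cB' := adj_cov_suml hK a13.
(* In the coplanar case a cover [A4] outside [sums A1 A2] mediates: [F A1] has the same intersection
   with [F A2] as with [F A4], and the latter lies in [F A3]. *)
have [|v [_ nv]] := @dims_outside _ _ hK hfin (sums A1 A2) (fulls V).
  by rewrite (dims_cov hK hfin cB) (cov_dimsA c1) dV; lia.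
have nAv : ~ A v by move=> Av; apply/nv/suml/(cov_les c1).
pose A4 := exts A v; have c4 : cov A A4 by apply: cov_ext.
have A4v : A4 v by apply: ext_self.
have n4 : ~ les A4 (sums A1 A2) by move=> h; apply/nv/h.
have n14 : A1 <> A4 by move=> e; apply/nv/suml; rewrite e.
have e123 : sums A1 A3 = sums A1 A2.
  have l : les (sums A1 A3) (sums A1 A2) by apply: sum_les => //; apply: suml.
  by case: (cov_between hK cB (@suml _ _ A1 A3) l) => // e; case: (cov_neq cB').
have n3 : ~ les A3 (sums A1 A4).
  move=> h; have [_ a14] := cov_meet hK c1 c4 n14.
  have l : les (sums A1 A3) (sums A1 A4) by apply: sum_les => //; apply: suml.
  case: (cov_between hK (adj_cov_suml hK a14) (@suml _ _ A1 A3) l) => e.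
    by case: (cov_neq cB').
  by apply: nv; rewrite -e123 e; apply: sumr.
rewrite -(cap_rot hK' (meet_image_adj c1 c2 n12) (meet_image_adj c1 c4 n14)).
  exact: meet_image_star_nonplanar.
exact: meet_image_star_nonplanar.
Qed.

(** Every member of [inG] above [A] contains a cover of [A], so by [meet_image_star] two covers
    already cut out [F A]; their images are adjacent of dimension [k.+1]. *)
Lemma dims_meet_image : dims (F A) = k.
Proof.
have [|v1 [_ nv1]] := @dims_outside _ _ hK hfin A (fulls V); first by rewrite dA dV; lia.
pose A1 := exts A v1; have c1 : cov A A1 by apply: cov_ext.
have [|v2 [_ nv2]] := @dims_outside _ _ hK hfin A1 (fulls V).
  by rewrite (cov_dimsA c1) dV; lia.
have nAv2 : ~ A v2 by move=> h; apply/nv2/ext_les.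
pose A2 := exts A v2; have c2 : cov A A2 by apply: cov_ext.
have n12 : A1 <> A2 by move=> e; apply: nv2; rewrite e; apply: ext_self.
have -> : F A = caps (F A1) (F A2).
  apply: sub_ext.
    by apply: les_cap; apply: meet_image_mono; apply: ext_les.
  move=> v hv _ [X [GX lX ->]].
  have dX := (GE X).1 GX.
  have [||A3 [lA lX3 d3]] := @interpolate _ _ hK hfin A X k.+1 lX; [by rewrite dA|by rewrite dX|].
  have c3 : cov A A3 by apply: cov_dims; rewrite ?dA.
  by apply: (meet_image_les GX lX3); apply: (meet_image_star c1 c2 c3 n12).
have [c _] := meet_image_adj c1 c2 n12.
have := dims_cov hK' hfin' c; rewrite dF (cov_dimsA c1); last by lia.
by move=> [].
Qed.

End Level.
End Descent.

Section Chow.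
Variables (K K' : unitRingType) (hK : division_ring K) (hK' : division_ring K').
Variables (V : lmodType K) (V' : lmodType K') (m : nat).
Hypotheses (hfin : findim (fulls V)) (dV : dims (fulls V) = (2 * m)%N).
Hypotheses (hfin' : findim (fulls V')) (dV' : dims (fulls V') = (2 * m)%N).
Hypothesis m2 : (2 <= m)%N.
Hypothesis GE : forall X : sub V, inG X <-> dims X = m.
Hypothesis GE' : forall X : sub V', inG X <-> dims X = m.
Variables (Phi : sub V -> sub V') (Psi : sub V' -> sub V).
Hypothesis iso : compl_iso Phi Psi.
Hypothesis col : collineation Phi.

Local Notation F := (meet_image Phi).
Local Notation F' := (meet_image Psi).

Lemma collineation_inv : collineation Psi.
Proof.
have [h1 h2 h3 h4 _] := iso; have iso' := compl_iso_sym iso.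
move=> X Y Z GX a1 a2 a3; have GY := inG_adj hK' a1 GX; have GZ := inG_adj hK' a2 GX.
have b (U W : sub V') : inG U -> inG W -> adj U W -> adj (Psi U) (Psi W).
  by move=> GU GW; apply: (compl_iso_adj hK' hK iso').
have := col (h2 _ GX) (b _ _ GX GY a1) (b _ _ GX GZ a2) (b _ _ GY GZ a3).
by rewrite /keeps_kind !h4 // => -[? ?]; split.
Qed.

Lemma meet_image_dims k : (k <= m)%N ->
  (forall A : sub V, (m - k <= dims A <= m)%N -> dims (F A) = dims A) /\
  (forall A : sub V', (m - k <= dims A <= m)%N -> dims (F' A) = dims A).
Proof.
have [h1 h2 _ _ _] := iso; have iso' := compl_iso_sym iso.
elim: k => [|k IH] km.
  split=> A d; have dA : dims A = m by lia.
    have GA : inG A by apply/GE.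
    by rewrite (meet_image_G hK hfin GE) // dA; apply/GE'/h1.
  have GA : inG A by apply/GE'.
  by rewrite (meet_image_G hK' hfin' GE') // dA; apply/GE/h2.
have [IH1 IH2] := IH (ltnW km).
split=> A d; have [ge|lt] := leqP (m - k) (dims A).
- by apply: IH1; lia.
- have dA : dims A = (m - k.+1)%N by lia.
  rewrite dA; apply: (dims_meet_image hK hK' hfin dV hfin' GE iso col) => //; last by lia.
    by move=> B dB; apply: IH1; lia.
  by move=> B dB; apply: IH2; lia.
- by apply: IH2; lia.
- have dA : dims A = (m - k.+1)%N by lia.
  rewrite dA.
  apply: (dims_meet_image hK' hK hfin' dV' hfin GE' iso' collineation_inv) => //; last by lia.
    by move=> B dB; apply: IH2; lia.
  by move=> B dB; apply: IH1; lia.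
Qed.

Lemma dims_meet_imageE (A : sub V) : (dims A <= m)%N -> dims (F A) = dims A.
Proof. by move=> d; apply: (meet_image_dims (leqnn m)).1; rewrite subnn. Qed.

Lemma dims_meet_imageE' (A : sub V') : (dims A <= m)%N -> dims (F' A) = dims A.
Proof. by move=> d; apply: (meet_image_dims (leqnn m)).2; rewrite subnn. Qed.

Lemma meet_image_cancel (A : sub V) : (dims A <= m)%N -> F' (F A) = A.
Proof.
move=> d; apply: dims_les_eq => //; first exact: (meet_imageK_les hK hfin dV GE iso).
by rewrite dims_meet_imageE' ?dims_meet_imageE.
Qed.

Lemma meet_image_cancel' (A : sub V') : (dims A <= m)%N -> F (F' A) = A.
Proof.
move=> d; apply: dims_les_eq => //.
  exact: (meet_imageK_les hK' hfin' dV' GE' (compl_iso_sym iso)).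
by rewrite dims_meet_imageE ?dims_meet_imageE'.
Qed.

(** The nontrivial inclusion is pulled back along [F'], where it can be checked on [A] and [B]
    separately. *)
Lemma meet_image_sum (A B : sub V) : (dims (sums A B) <= m)%N -> F (sums A B) = sums (F A) (F B).
Proof.
move=> d; have l : les (sums (F A) (F B)) (F (sums A B)).
  by apply: sum_les; apply: meet_image_mono; [apply: suml|apply: sumr].
have dA : (dims A <= m)%N by apply: leq_trans d; apply: dims_les => //; apply: suml.
have dB : (dims B <= m)%N by apply: leq_trans d; apply: dims_les => //; apply: sumr.
apply: sub_ext => //; rewrite -[sums (F A) (F B)]meet_image_cancel'; last first.
  by apply: leq_trans (dims_les hK' hfin' l) _; rewrite dims_meet_imageE.
apply: meet_image_mono; apply: sum_les.
  by rewrite -{1}(meet_image_cancel dA); apply: meet_image_mono; apply: suml.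
by rewrite -{1}(meet_image_cancel dB); apply: meet_image_mono; apply: sumr.
Qed.

Theorem chow : exists s f, [/\ ring_iso s, @semilinear_bij K K' V V' s f &
  forall (X : sub V) y, inG X -> (Phi X y <-> exists x, X x /\ f x = y)].
Proof.
pose Q x := F (lines x).
have d1 x : (dims (lines x : sub V) <= m)%N.
  by apply: leq_trans (dims_line_le hK hfin x) _; lia.
have d1' y : (dims (lines y : sub V') <= m)%N.
  by apply: leq_trans (dims_line_le hK' hfin' y) _; lia.
(* Here [m >= 2] matters: the span of two vectors stays in the range where [F] is invertible. *)
have d2 x y : (dims (span2 x y : sub V) <= m)%N.
  apply: leq_trans m2; rewrite (leq_trans (dims_ext_le hK hfin _ _)) // ltnS.
  exact: dims_line_le.
have Qline x : x <> 0 -> exists q, q <> 0 /\ Q x = lines q.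
  by move=> x0; apply: (dims1_line hK' hfin'); rewrite dims_meet_imageE // dims_line.
have Qsurj v : v <> 0 -> exists x, x <> 0 /\ Q x v.
  move=> v0; have [|x [x0 ex]] := @dims1_line _ _ hK hfin (F' (lines v)).
    by rewrite dims_meet_imageE' // dims_line.
  by exists x; split=> //; rewrite /Q -ex meet_image_cancel' //; apply: line_self.
have Qspan x y z : x <> 0 -> y <> 0 -> z <> 0 ->
    (span2 x y z <-> les (Q z) (sums (Q x) (Q y))).
  move=> _ _ _; rewrite /Q -(@meet_image_sum (lines x) (lines y) (d2 x y)); split=> [h|h].
    by apply: meet_image_mono; apply: line_les.
  have: les (lines z) (span2 x y).
    by rewrite -(meet_image_cancel (d1 z)) -(meet_image_cancel (d2 x y)); apply: meet_image_mono.
  by apply; apply: line_self.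
have dim4 (a b c : V) : exists z, ~ exts (span2 a b) c z.
  have [|z [_ nz]] := @dims_outside _ _ hK hfin (exts (span2 a b) c) (fulls V); last by exists z.
  have h1 := dims_ext_le hK hfin (span2 a b) c.
  have h2 : (dims (span2 a b) <= (dims (lines a)).+1)%N := dims_ext_le hK hfin (lines a) b.
  by have h3 := dims_line_le hK hfin a; rewrite dV; lia.
have [s [f [si sf fQ]]] := fundamental_theorem hK hK' Qline Qsurj Qspan dim4.
exists s, f; split=> // X y GX; have [fb fD fZ] := sf.
have f0 : f 0 = 0 by apply: (addrI (f 0)); rewrite -fD !addr0.
have dX : (dims X <= m)%N by rewrite (GE X).1.
have fX x : X x -> Phi X (f x).
  move=> Xx; have [-> |/eqP x0] := eqVneq x 0; first by rewrite f0; apply: sub0.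
  by apply: (meet_image_les GX (line_les Xx)); apply: fQ.
split=> [Xy|[x [Xx <-]]]; last exact: fX.
have [h _ fh] := fb; exists (h y); rewrite fh; split=> //.
have [y0|/eqP y0] := eqVneq (h y) 0; first by rewrite y0; apply: sub0.
(* Applying [F'] to the inclusion of [lines y] in [Phi X] brings [lines (h y)] back into [X]. *)
have e : Q (h y) = lines y.
  rewrite -[in RHS](fh y); apply: (Q_eq_line hK' Qline) => //; last exact: fQ.
  by rewrite fh => y0'; apply: y0; apply: (bij_inj fb); rewrite fh f0.
have: les (lines (h y)) X.
  rewrite -(meet_image_cancel (d1 (h y))) -(meet_image_cancel dX); apply: meet_image_mono.
  by rewrite (meet_image_G hK hfin GE _ GX) [F _]e; apply: line_les.
by apply; apply: line_self.
Qed.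

End Chow.

(** * Duality *)

Section Pairing.
Variables (K : unitRingType) (V : lmodType K) (W : lmodType K^c).

(* [W] is a left space over the opposite ring, i.e. a right space over [K] playing the
   role of the dual space of [V]. *)
Definition perfect_pairing (b : V -> W -> K) :=
  [/\ forall w, functional (b^~ w),
      forall v w w', b v (w + w') = b v w + b v w',
      forall v (a : K) w, b v ((a : K^c) *: w) = b v w * a,
      forall p, functional p -> exists w, forall v, p v = b v w &
      forall w, (forall v, b v w = 0) -> w = 0].

Variables (b : V -> W -> K) (hb : perfect_pairing b).
Hypothesis hK : division_ring K.

Let hKc : division_ring K^c := hK.

Lemma pairing0r v : b v 0 = 0.
Proof.
have [_ hD _ _ _] := hb.
by apply: (addrI (b v 0)); rewrite -hD !addr0.
Qed.

Lemma pairingDl w v v' : b (v + v') w = b v w + b v' w.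
Proof. by have [hp _ _ _ _] := hb; have [h _] := hp w. Qed.

Lemma pairingZl w a v : b (a *: v) w = a * b v w.
Proof. by have [hp _ _ _ _] := hb; have [_ h] := hp w. Qed.

Lemma pairing0l w : b 0 w = 0.
Proof. by apply: (addrI (b 0 w)); rewrite -pairingDl !addr0. Qed.

Lemma pairing_ext w w' : (forall v, b v w = b v w') -> w = w'.
Proof.
have [_ hD hZ _ h0] := hb => e; apply/eqP; rewrite -subr_eq0; apply/eqP; apply: h0 => v.
have -> : - w' = (-1 : K^c) *: w' by rewrite scaleN1r.
by rewrite hD hZ mulrN1 e subrr.
Qed.

Lemma perp_subspace (A : sub V) : subspace (fun w => forall x, A x -> b x w = 0).
Proof.
have [_ hD hZ _ _] := hb; split=> [x _|w w' hw hw' x Ax|a w hw x Ax].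
- exact: pairing0r.
- by rewrite hD hw // hw' // addr0.
- by rewrite hZ hw // mul0r.
Qed.
Definition perp A := Sub (perp_subspace A).

Lemma lperp_subspace (B : sub W) : subspace (fun v => forall w, B w -> b v w = 0).
Proof.
split=> [w _|v v' hv hv' w Bw|a v hv w Bw].
- exact: pairing0l.
- by rewrite pairingDl hv // hv' // addr0.
- by rewrite pairingZl hv // mulr0.
Qed.
Definition lperp B := Sub (lperp_subspace B).

Lemma perp_sep (A : sub V) v : ~ A v -> exists w, perp A w /\ b v w = 1.
Proof.
move=> nAv; have [p [fp p0 p1]] := functional_sep hK nAv.
have [_ _ _ hr _] := hb; have [w hw] := hr p fp.
by exists w; split=> [x Ax|]; rewrite -hw // p0.
Qed.

Lemma perp_reflect A B : les (perp B) (perp A) -> les A B.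
Proof.
move=> l v Av; apply: contrapT => nBv; have [w [Bw e]] := perp_sep nBv.
by move: (l w Bw v Av) => /eqP; rewrite e oner_eq0.
Qed.

Lemma perpK A : lperp (perp A) = A.
Proof.
apply: sub_ext => [v hv|v Av w Aw]; last exact: Aw.
apply: contrapT => nAv; have [w [Aw e]] := perp_sep nAv.
by move: (hv w Aw) => /eqP; rewrite e oner_eq0.
Qed.

(** Take [w0] vanishing on [A] with value 1 at [v]: subtracting a suitable multiple of [w0] makes
    any element of [perp A] vanish at [v] too. *)
Lemma cov_perp A B : cov A B -> cov (perp B) (perp A).
Proof.
move=> [v [nAv ->]]; have [w0 [Aw0 e]] := perp_sep nAv.
have [_ hD hZ _ _] := hb.
exists w0; split=> [/(_ v (ext_self A v))/eqP|]; first by rewrite e oner_eq0.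
apply: sub_ext; last first.
  by apply: ext_leP => // w h x Ax; apply: h; apply: ext_les.
move=> w Aw; exists (w + ((- b v w : K) : K^c) *: w0), (((b v w : K) : K^c) *: w0); split.
- move=> _ /extP[a [y [Ay ->]]]; rewrite hD hZ !pairingDl !pairingZl (Aw y Ay) (Aw0 y Ay) e.
  by rewrite !add0r mulr1 mulrN subrr.
- by exists (b v w).
by rewrite -addrA -scalerDl addNr scale0r addr0.
Qed.

Lemma perp_sum A B : perp (sums A B) = caps (perp A) (perp B).
Proof.
apply: sub_ext => [w h|w [hA hB] _ [x [y [Ax By ->]]]].
  by split=> x Ax; apply: h; [apply: suml|apply: sumr].
by rewrite pairingDl hA // hB // addr0.
Qed.

Variable n : nat.
Hypotheses (hfin : findim (fulls V)) (dV : dims (fulls V) = n).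
Hypotheses (hfinW : findim (fulls W)) (dW : dims (fulls W) = n).

Lemma dims_perp A : (dims (perp A) + dims A)%N = n.
Proof.
suff h k B : hasdim k B -> (dims (perp B) + k)%N = n by apply/h/dimsP.
elim: k B => [|k IH] B /=.
  move=> ->; rewrite addn0 -dW; congr dims; apply: sub_ext => // w _ _ ->.
  exact: pairing0l.
move=> [C [dC c]]; by rewrite -(IH C dC) (dims_cov hKc hfinW (cov_perp c)) addSn addnS.
Qed.

(** One further linear condition costs at most one dimension: a [v0] violating it can be used to
    correct every other vector. *)
Lemma dims_lperp_cov A B : cov A B -> (dims (lperp A) <= (dims (lperp B)).+1)%N.
Proof.
have [_ hD hZ _ _] := hb; move=> [w [nAw ->]].
have [h|/existsNP[v0 /not_implyP[Av0 n0]]] := pselect (forall v, lperp A v -> b v w = 0).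
  apply: leqW; apply: dims_les => // v Av _ /extP[a [y [Ay ->]]].
  by rewrite hD hZ (Av y Ay) h // mul0r addr0.
apply: leq_trans (dims_ext_le hK hfin _ v0); apply: dims_les => // v Av.
have u : b v0 w \is a GRing.unit by apply: hK; apply/eqP.
exists (v + (- (b v w / b v0 w)) *: v0), ((b v w / b v0 w) *: v0); split.
- move=> _ /extP[a [y [Ay ->]]]; rewrite hD hZ !pairingDl !pairingZl (Av y Ay) (Av0 y Ay).
  by rewrite mulr0 !add0r mulNr divrK // subrr mul0r.
- by exists (b v w / b v0 w).
by rewrite -addrA -scalerDl addNr scale0r addr0.
Qed.

(** Counting: [lperp B] has dimension at least [n] minus that of [B], so by [dims_perp] the space
    [perp (lperp B)], which contains [B], is no larger. *)
Lemma lperpK B : perp (lperp B) = B.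
Proof.
suff h k C : hasdim k C -> (n <= dims (lperp C) + k)%N.
  symmetry; apply: (dims_les_eq hKc hfinW) => [w Bw v hv|]; first exact: hv.
  rewrite -(leq_add2r (dims (lperp B))) dims_perp addnC.
  exact: (h _ _ (dimsP hKc hfinW B)).
elim: k C => [|k IH] C /=.
  move=> ->; rewrite addn0 -dV; apply: dims_les => // v _ _ ->; exact: pairing0r.
move=> [D [dD c]]; apply: leq_trans (IH D dD) _.
by rewrite addnS -addSn leq_add2r; apply: dims_lperp_cov.
Qed.

(** Annihilators turn a sum into an intersection, and for subspaces of half dimension spanning and
    meeting trivially are equivalent. *)
Lemma direct_sum_perp m A B : n = (2 * m)%N -> dims A = m -> dims B = m ->
  (direct_sum A B <-> direct_sum (perp A) (perp B)).
Proof.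
move=> en dA dB.
have dP C : dims C = m -> dims (perp C) = m by move=> dC; have := dims_perp C; rewrite dC; lia.
have pA := dP A dA; have pB := dP B dB.
have pAB := dims_perp (sums A B); rewrite perp_sum in pAB.
split=> d.
- apply: (direct_sum_cap hKc hfinW); first by rewrite dW pA pB; lia.
  apply: (dims_eq0 hKc hfinW).
  have e := dims_sum_cap hK hfin A B.
  have c0 : caps A B = zeros V.
    by apply: sub_ext => [v [Av Bv]|]; [apply: d.1|apply: les0].
  have sAB : dims (sums A B) = n by move: e; rewrite c0 dims0 // dA dB; lia.
  by move: pAB; rewrite sAB => /eqP; rewrite -[X in _ == X]add0n eqn_add2r => /eqP.
apply: direct_sum_sum => //; first by rewrite dV dA dB; lia.
have c0 : caps (perp A) (perp B) = zeros W.
  by apply: sub_ext => [v [Av Bv]|]; [apply: d.1|apply: les0].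
apply: dims_les_eq => //; rewrite dV.
by move: pAB; rewrite c0 dims0 // => <-.
Qed.

End Pairing.

Lemma row_pairing (K : unitRingType) (V : lmodType K) n : has_dim V n ->
  exists b : V -> 'rV[K^c]_n -> K, perfect_pairing b.
Proof.
move=> [c [lc [c' cK c'K]]]; have lc' := bij_inv_linmap lc cK c'K.
(* The entries of [w] stand on the right, so scalars of [K^c] act as right scalars of [K]. *)
pose b v (w : 'rV[K^c]_n) : K := \sum_i (c v 0 i * (w 0 i : K)).
exists b; split.
- move=> w; split=> [x y|a x]; rewrite /b.
    by rewrite -big_split; apply: eq_bigr => i _; rewrite lc.1 mxE mulrDl.
  by rewrite mulr_sumr; apply: eq_bigr => i _; rewrite lc.2 mxE mulrA.
- by move=> v w w'; rewrite /b -big_split; apply: eq_bigr => i _; rewrite mxE mulrDr.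
- by move=> v a w; rewrite /b mulr_suml; apply: eq_bigr => i _; rewrite mxE; apply: mulrA.
- move=> p [pD pZ]; exists (\row_i (p (c' (delta_mx 0 i)))) => v.
  have p0 : p 0 = 0 by apply: (addrI (p 0)); rewrite -pD !addr0.
  have psum (I : Type) (r : seq I) (F : I -> 'rV[K]_n) :
      p (c' (\sum_(i <- r) F i)) = \sum_(i <- r) p (c' (F i)).
    by apply: (big_morph (fun u => p (c' u))) => [x y|]; rewrite ?lc'.1 ?pD ?(linmap0 lc').
  rewrite -[in LHS](cK v) [c v]row_sum_delta psum; apply: eq_bigr => i _.
  by rewrite lc'.2 pZ mxE.
move=> w h; apply/rowP => j; rewrite mxE -(h (c' (delta_mx 0 j))) /b c'K.
rewrite (bigD1 j) //= mxE !eqxx mul1r big1 ?addr0 // => i ij.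
by rewrite mxE eqxx (negbTE ij) mul0r.
Qed.

(** With coordinates split into halves, moving the first half into the second place is a map whose
    image and kernel are both the vectors with first half 0. *)
Lemma exists_inG (K : unitRingType) (V : lmodType K) m : has_dim V (2 * m)%N ->
  exists X : sub V, inG X.
Proof.
rewrite mul2n -addnn => -[c [lc [c' cK c'K]]]; have lc' := bij_inv_linmap lc cK c'K.
have sX : subspace (fun v => lsubmx (c v) = 0).
  split=> [|x y hx hy|a x hx]; first by rewrite (linmap0 lc) linear0.
    by rewrite lc.1 linearD /= hx hy addr0.
  by rewrite lc.2 linearZ /= hx scaler0.
exists (Sub sX); split=> //; exists (fun v => c' (row_mx 0 (lsubmx (c v)))); split.
- split=> [x y|a x].
    by rewrite -lc'.1 add_row_mx addr0 lc.1 linearD.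
  by rewrite -lc'.2 scale_row_mx scaler0 lc.2 linearZ.
- by move=> v /=; rewrite c'K row_mxKl.
- move=> x /= hx; exists (c' (row_mx (rsubmx (c x)) 0)).
  by rewrite c'K row_mxKl -[RHS]cK -(hsubmxK (c x)) hx row_mxKr.
move=> v /=; split=> [e|->]; last by rewrite row_mx0 (linmap0 lc').
have: row_mx 0 (lsubmx (c v)) = 0 :> 'rV_(m + m).
  by apply: (can_inj c'K); rewrite e (linmap0 lc').
by move=> /(congr1 rsubmx); rewrite row_mxKr linear0.
Qed.

Lemma inGE (K : unitRingType) (hK : division_ring K) (V : lmodType K) m :
  has_dim V (2 * m)%N -> forall X : sub V, inG X <-> dims X = m.
Proof.
move=> hV X; have dV := has_dim_hasdim hV.
have hfin : findim (fulls V) by exists (2 * m)%N.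
have eV := dims_eq hK dV; have [X0 G0] := exists_inG hV.
split=> [GX|dX]; first by have := inG_dims hK hfin GX; lia.
exact: (dims_inG hK hfin eV G0 dX).
Qed.

Lemma compl_iso_comp (K1 K2 K3 : unitRingType) (V1 : lmodType K1) (V2 : lmodType K2)
    (V3 : lmodType K3) (P12 : sub V1 -> sub V2) (P21 : sub V2 -> sub V1)
    (P23 : sub V2 -> sub V3) (P32 : sub V3 -> sub V2) :
  compl_iso P12 P21 -> compl_iso P23 P32 -> compl_iso (P23 \o P12) (P21 \o P32).
Proof.
move=> [a1 a2 a3 a4 a5] [b1 b2 b3 b4 b5]; split=> /=.
- by move=> X GX; apply/b1/a1.
- by move=> Y GY; apply/a2/b2.
- by move=> X GX; rewrite b3 ?a3 //; apply: a1.
- by move=> Y GY; rewrite a4 ?b4 //; apply: b2.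
- by move=> X Y GX GY; rewrite a5 // b5 //; apply: a1.
Qed.

Section Duality.
Variables (K : unitRingType) (hK : division_ring K) (V : lmodType K) (W : lmodType K^c).
Variables (b : V -> W -> K) (hb : perfect_pairing b) (m : nat).
Hypotheses (hV : has_dim V (2 * m)%N) (hW : has_dim W (2 * m)%N).

Let hKc : division_ring K^c := hK.
Let hfin : findim (fulls V). Proof. by exists (2 * m)%N; apply: has_dim_hasdim. Qed.
Let hfinW : findim (fulls W). Proof. by exists (2 * m)%N; apply: has_dim_hasdim. Qed.
Let dV : dims (fulls V) = (2 * m)%N.
Proof. by apply: dims_eq => //; apply: has_dim_hasdim. Qed.
Let dW : dims (fulls W) = (2 * m)%N.
Proof. by apply: (dims_eq hKc); apply: has_dim_hasdim. Qed.

Lemma direct_sum_perpE (X Y : sub V) : inG X -> inG Y ->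
  (direct_sum X Y <-> direct_sum (perp hb X) (perp hb Y)).
Proof.
move=> /(inGE hK hV) dX /(inGE hK hV) dY.
exact: (direct_sum_perp hb hK hfin dV hfinW dW erefl dX dY).
Qed.

Lemma inG_perp (X : sub V) : inG X -> inG (perp hb X).
Proof.
move=> /(inGE hK hV) dX; apply/(inGE hKc hW).
have e := dims_perp hb hK hfin hfinW dW X; rewrite dX mul2n -addnn in e.
exact: addIn e.
Qed.

Lemma inG_lperp (Y : sub W) : inG Y -> inG (lperp hb Y).
Proof.
move=> /(inGE hKc hW) dY; apply/(inGE hK hV).
have := dims_perp hb hK hfin hfinW dW (lperp hb Y).
by rewrite (lperpK hb hK hfin dV hfinW dW) dY mul2n -addnn => /addnI.
Qed.

Lemma compl_iso_perp : compl_iso (perp hb) (lperp hb).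
Proof.
split.
- exact: inG_perp.
- exact: inG_lperp.
- by move=> X _; apply: perpK.
- by move=> Y _; apply: (lperpK hb hK hfin dV hfinW dW).
- exact: direct_sum_perpE.
Qed.

(** The intersection of the annihilators is the annihilator of [sums X Y], so a star of annihilators
    would put [Z] into [sums X Y]. *)
Lemma perp_tri_kind (X Y Z : sub V) : tri X Y Z -> les (caps X Y) Z ->
  ~ les (caps (perp hb X) (perp hb Y)) (perp hb Z).
Proof.
by move=> t s; rewrite -perp_sum => /(perp_reflect hK); apply: tri_star t s.
Qed.

End Duality.

Lemma exists_adj (K : unitRingType) (hK : division_ring K) (V : lmodType K) m :
  has_dim V (2 * m)%N -> (0 < m)%N -> exists X Y : sub V, inG X /\ adj X Y.
Proof.
move=> hV m0; have hfin : findim (fulls V) by exists (2 * m)%N; apply: has_dim_hasdim.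
have dV : dims (fulls V) = (2 * m)%N by apply: dims_eq => //; apply: has_dim_hasdim.
have [X GX] := exists_inG hV; have dX := (inGE hK hV X).1 GX.
have [||H [_ lHX dH]] := @interpolate _ _ hK hfin (zeros V) X m.-1 (@les0 _ _ X).
- by rewrite dims0.
- by rewrite dX leq_pred.
have [|v [_ nXv]] := @dims_outside _ _ hK hfin X (fulls V); first by rewrite dX dV; lia.
have nHv : ~ H v by move=> /lHX.
exists X, (exts H v); split=> //; apply: (cov_meet hK (A := H) _ (cov_ext nHv) _).2.
  by apply: cov_dims => //; rewrite dX dH; lia.
by move=> e; apply: nXv; rewrite e; apply: ext_self.
Qed.

Section Classification.
Variables (K K' : unitRingType) (hK : division_ring K) (hK' : division_ring K').
Variables (V : lmodType K) (V' : lmodType K') (m : nat).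
Hypotheses (hV : has_dim V (2 * m)%N) (hV' : has_dim V' (2 * m)%N) (m2 : (2 <= m)%N).
Variables (Phi : sub V -> sub V') (Psi : sub V' -> sub V).
Hypothesis iso : compl_iso Phi Psi.

Theorem chow_dual :
  (exists s f, [/\ ring_iso s, @semilinear_bij K K' V V' s f &
     forall (X : sub V) y, inG X -> (Phi X y <-> exists x, X x /\ f x = y)]) \/
  (exists (s : K -> K') (f : (V -> K) -> V'), [/\ ring_antiiso s, dual_semilinear_bij s f &
     forall (X : sub V) y, inG X -> (Phi X y <->
       exists p, [/\ functional p, (forall x, X x -> p x = 0) & f p = y])]).
Proof.
have hfin : findim (fulls V) by exists (2 * m)%N; apply: has_dim_hasdim.
have dV : dims (fulls V) = (2 * m)%N by apply: dims_eq => //; apply: has_dim_hasdim.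
have hfin' : findim (fulls V') by exists (2 * m)%N; apply: has_dim_hasdim.
have dV' : dims (fulls V') = (2 * m)%N by apply: dims_eq => //; apply: has_dim_hasdim.
have GE := inGE hK hV; have GE' := inGE hK' hV'.
have [X [Y [GX aXY]]] := exists_adj hK hV (ltnW m2).
have [k|nk] := pselect (keeps_kinds Phi X Y).
  left; apply: (chow hK hK' hfin dV hfin' dV' m2 GE GE' iso).
  exact: (keeps_kinds_collineation hK hK' hfin dV m2 GE iso GX aXY k).
right; have [b hb] := row_pairing hV.
have hKc : division_ring K^c := hK.
have hW : has_dim 'rV[K^c]_(2 * m) (2 * m)%N by exists id; split=> //; exists id.
have hfinW : findim (fulls 'rV[K^c]_(2 * m)) by exists (2 * m)%N; apply: has_dim_hasdim.
have dW : dims (fulls 'rV[K^c]_(2 * m)) = (2 * m)%N.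
  by apply: (dims_eq hKc); apply: has_dim_hasdim.
have isoP := compl_iso_perp hK hb hV hW.
have iso2 := compl_iso_comp (compl_iso_sym isoP) iso.
have [GP _ _ _ _] := isoP.
have [Z [t s _]] := exists_star hK hfin dV m2 ((GE X).1 GX) aXY.
have [GY GZ] := tri_G hK GX t.
have tW := compl_iso_tri hK hKc isoP GX GY GZ t.
(* Both sides are false: annihilators do not form a star by [perp_tri_kind], and if [Phi] kept the
   star [Z] it would keep kinds over the whole edge, against [nk]. *)
have kW : keeps_kind (Phi \o lperp hb) (perp hb X) (perp hb Y) (perp hb Z).
  rewrite /keeps_kind /= !perpK //; split=> [/(perp_tri_kind hK t s)//|h].
  by case: nk; apply: (keeps_kind_all hK hK' iso GX t).
have kkW := keeps_kind_all hKc hK' iso2 (GP _ GX) tW kW.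
have aW : adj (perp hb X) (perp hb Y) by case: tW.
have col := keeps_kinds_collineation hKc hK' hfinW dW m2 (inGE hKc hW) iso2 (GP _ GX) aW kkW.
have [s' [g [[sb sD sM] [gb gD gZ] gP]]] :=
  chow hKc hK' hfinW dW hfin' dV' m2 (inGE hKc hW) GE' iso2 col.
have [hp bD bZ br b0] := hb.
(* Dual vectors are functions satisfying a predicate; off the functionals the representing row is
   arbitrary. *)
have ex p : exists w, functional p -> forall v, p v = b v w.
  have [fp|nfp] := pselect (functional p); last by exists 0.
  by have [w hw] := br p fp; exists w.
have [rep hrep] := choice ex.
have rep_eq p w : functional p -> (forall v, p v = b v w) -> rep p = w.
  by move=> fp e; apply: (pairing_ext hb) => v; rewrite -e hrep.
exists s', (fun p => g (rep p)); split.
- by split=> // x y; apply: sM.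
- split.
  + move=> p q fp fq /(bij_inj gb) e; apply: funext => v.
    by rewrite (hrep p fp) (hrep q fq) e.
  + have [g' _ gK] := gb; move=> y; exists (b^~ (g' y)); split; first exact: hp.
    by rewrite (rep_eq _ (g' y)) // gK.
  + move=> p q fp fq; rewrite -gD; congr g; apply: rep_eq.
      have [p1 p2] := fp; have [q1 q2] := fq; split=> [x y|a x].
        by rewrite p1 q1 addrACA.
      by rewrite p2 q2 mulrDr.
    by move=> v; rewrite bD -!hrep.
  + move=> p a fp; rewrite -gZ; congr g; apply: rep_eq.
      have [p1 p2] := fp; split=> [x y|c x]; first by rewrite p1 mulrDl.
      by rewrite p2 mulrA.
    by move=> v; rewrite bZ -hrep.
move=> U y GU; have := gP (perp hb U) y (GP _ GU); rewrite /= perpK // => ->.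
split=> [[w [hw <-]]|[p [fp hU <-]]].
  by exists (b^~ w); split=> //; rewrite (rep_eq _ w).
by exists (rep p); split=> // x Ux; rewrite -hrep // hU.
Qed.

End Classification.

(** * The classification *)

Section GrassmannSubspaces.
Variables (K : unitRingType) (V : lmodType K).

Definition gsub (X : Gset V) : sub V := Sub (proj1 (proj2_sig X)).

Lemma gsub_inG X : inG (gsub X).
Proof. by case: X. Qed.

Lemma gsub_inj X Y : gsub X = gsub Y -> X = Y.
Proof.
case: X Y => [X GX] [Y GY] [e]; subst Y.
by congr exist; apply: Prop_irrelevance.
Qed.

Lemma gsub_surj (A : sub V) : inG A -> exists X, gsub X = A.
Proof.
case: A => [A sA] GA; exists (exist _ A GA); apply: sub_ext => //.
Qed.

End GrassmannSubspaces.

Section Induced.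
Variables (K K' : unitRingType) (V : lmodType K) (V' : lmodType K').

Definition sub_of (phi : Gset V -> Gset V') (A : sub V) : sub V' :=
  if pselect (inG A) is left h then gsub (phi (exist _ (carrier A) h)) else zeros V'.

Lemma sub_ofE phi X : sub_of phi (gsub X) = gsub (phi X).
Proof.
rewrite /sub_of; case: pselect => [h|[]]; last exact: gsub_inG.
by congr (gsub (phi _)); apply: gsub_inj; apply: sub_ext.
Qed.

Lemma sub_of_inG phi (A : sub V) : inG A -> inG (sub_of phi A).
Proof. by move=> /gsub_surj[X <-]; rewrite sub_ofE; apply: gsub_inG. Qed.

End Induced.

Lemma distant_compl_iso (K K' : unitRingType) (V : lmodType K) (V' : lmodType K')
    (phi : Gset V -> Gset V') (psi : Gset V' -> Gset V) :
  cancel phi psi -> cancel psi phi -> distant_iso phi ->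
  compl_iso (sub_of phi) (sub_of psi).
Proof.
move=> c1 c2 d; split.
- by move=> X; apply: sub_of_inG.
- by move=> X; apply: sub_of_inG.
- by move=> X /gsub_surj[{}X <-]; rewrite !sub_ofE c1.
- by move=> X /gsub_surj[{}X <-]; rewrite !sub_ofE c2.
- by move=> X Y /gsub_surj[{}X <-] /gsub_surj[{}Y <-]; rewrite !sub_ofE; apply: d.
Qed.

(** The path bound is only an inequality; applied to the inverse as well, it gives equality. *)
Lemma compl_iso_has_dim (K K' : unitRingType) (hK : division_ring K)
    (hK' : division_ring K') (V : lmodType K) (V' : lmodType K') m
    (Phi : sub V -> sub V') (Psi : sub V' -> sub V) :
  compl_iso Phi Psi -> has_dim V (2 * m)%N -> has_dim V' (2 * m)%N.
Proof.
move=> iso hV; have dV := has_dim_hasdim hV.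
have hfin : findim (fulls V) by exists (2 * m)%N.
have eV := dims_eq hK dV; have [X GX] := exists_inG hV.
have [hfin' le1] := compl_iso_dims_le hK hK' iso hfin eV GX.
have GX' : inG (Phi X) by have [h _ _ _ _] := iso; apply: h.
have e' := inG_dims hK' hfin' GX'.
have [_ le2] := compl_iso_dims_le hK' hK (compl_iso_sym iso) hfin' (esym e') GX'.
have e : dims (fulls V') = (2 * m)%N by rewrite eV in le2; lia.
by apply: hasdim_has_dim => //; rewrite -e; apply: dimsP.
Qed.

(** * Dimension two: the projective line *)

Section Plane.
Variables (K : unitRingType) (hK : division_ring K) (V : lmodType K).
Hypothesis hV : has_dim V 2.

Lemma plane_findim : findim (fulls V).
Proof. by exists 2%N; apply: has_dim_hasdim. Qed.

Lemma plane_dims : dims (fulls V) = 2%N.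
Proof. by apply: dims_eq => //; apply: has_dim_hasdim. Qed.

Lemma plane_inG (X : sub V) : inG X <-> dims X = 1%N.
Proof. exact: (@inGE K hK V 1). Qed.

Lemma plane_direct_sum (X Y : sub V) : inG X -> inG Y -> (direct_sum X Y <-> X <> Y).
Proof.
move=> /plane_inG dX /plane_inG dY; split=> [[h _] e|n].
  have: X = zeros V by apply: sub_ext => [v Xv|]; [apply: h; rewrite -?e|apply: les0].
  by move=> e0; move: dX; rewrite e0 dims0.
apply: (direct_sum_cap hK plane_findim); first by rewrite plane_dims dX dY.
apply: (dims_eq0 hK plane_findim).
have := dims_les hK plane_findim (@capl _ _ X Y); rewrite dX leq_eqVlt => /orP[/eqP e|]; last first.
  by rewrite ltnS leqn0 => /eqP.
case: n; have e1 : caps X Y = X.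
  by apply: (dims_les_eq hK plane_findim); [apply: capl|rewrite e dX].
apply: (dims_les_eq hK plane_findim); last by rewrite dX dY.
by rewrite -e1; apply: capr.
Qed.

(** An affine chart of the projective line: [lines e2] is the point at infinity, and the scalar [a]
    labels the point [lines (e1 + a *: e2)]. *)
Variables (e1 e2 : V).
Hypotheses (e2_neq0 : e2 <> 0) (e1_free : ~ lines e2 e1).

Lemma affine_point_neq0 (a : K) : e1 + a *: e2 <> 0.
Proof.
move=> h; apply: e1_free; exists (- a).
by rewrite scaleNr; apply/eqP; rewrite -addr_eq0 h.
Qed.

Lemma affine_point_inG (a : K) : inG (lines (e1 + a *: e2)).
Proof. apply/plane_inG/(dims_line hK plane_findim)/affine_point_neq0. Qed.

Lemma affine_point_finite (a : K) : lines (e1 + a *: e2) <> lines e2.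
Proof.
move=> e; apply: e1_free.
have: lines e2 (e1 + a *: e2) by rewrite -e; apply: line_self.
move=> h; rewrite -[e1](addrK (a *: e2)); apply: subB => //.
exact/subZ/line_self.
Qed.

Lemma affine_point_inj (a a' : K) : lines (e1 + a *: e2) = lines (e1 + a' *: e2) -> a = a'.
Proof.
move=> e; apply: contrapT => /eqP; rewrite -subr_eq0 => n.
have h : lines (e1 + a *: e2) ((a - a') *: e2).
  have -> : (a - a') *: e2 = (e1 + a *: e2) - (e1 + a' *: e2).
    by rewrite opprD addrACA subrr add0r scalerBl.
  by apply: subB; [apply: line_self|rewrite e; apply: line_self].
have h2 := subZ_inv hK n h.
apply: (@affine_point_finite a); symmetry.
apply: (dims_les_eq hK plane_findim); first exact: line_les.
rewrite !(dims_line hK plane_findim) //; exact: affine_point_neq0.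
Qed.

Lemma affine_point_surj (X : sub V) : inG X -> X <> lines e2 ->
  exists a : K, X = lines (e1 + a *: e2).
Proof.
move=> /plane_inG dX n; have [v [v0 eX]] := dims1_line hK plane_findim dX.
have full : exts (lines e2) e1 = fulls V.
  apply: (dims_les_eq hK plane_findim) => //.
  by rewrite plane_dims (dims_ext hK plane_findim) // (dims_line hK plane_findim).
have: fulls V v by [].
rewrite -full => /extP[a [_ [[c ->] ev]]].
have a0 : a != 0.
  apply/eqP => a0; apply: n; rewrite eX; apply: (dims_les_eq hK plane_findim).
    by apply: line_les; exists c; rewrite ev a0 scale0r addr0.
  by rewrite !(dims_line hK plane_findim).
exists (a^-1 * c); symmetry; apply: (dims_les_eq hK plane_findim); last first.
  by rewrite dX (dims_line hK plane_findim) //; apply: affine_point_neq0.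
apply: line_les; rewrite eX; exists a^-1.
by rewrite ev scalerDr unscale // addrC scalerA.
Qed.

End Plane.

Lemma plane_frame (K : unitRingType) (hK : division_ring K) (V : lmodType K) (X : sub V) :
  has_dim V 2 -> inG X -> exists e1 e2, [/\ X = lines e2, e2 <> 0 & ~ lines e2 e1].
Proof.
move=> hV /(plane_inG hK hV) dX; have hfin := plane_findim hV.
have [e2 [n e]] := dims1_line hK hfin dX.
have [|e1 [_ h]] := @dims_outside _ _ hK hfin X (fulls V).
  by rewrite dX (plane_dims hK hV).
by exists e1, e2; rewrite -e.
Qed.

(** Taking a point and its image as the points at infinity leaves a bijection between the affine
    points, hence between the scalars, without cardinal arithmetic. *)
Lemma plane_scalars (K K' : unitRingType) (hK : division_ring K) (hK' : division_ring K')
    (V : lmodType K) (V' : lmodType K') (Phi : sub V -> sub V') (Psi : sub V' -> sub V) :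
  has_dim V 2 -> has_dim V' 2 -> compl_iso Phi Psi -> exists h : K -> K', bijective h.
Proof.
move=> hV hV' iso; have [h1 h2 h3 h4 _] := iso.
have [X GX] := @exists_inG K V 1 hV.
have [e1 [e2 [eX n2 n1]]] := plane_frame hK hV GX.
have [f1 [f2 [eY k2 k1]]] := plane_frame hK' hV' (h1 X GX).
have ex a : exists a' : K', Phi (lines (e1 + a *: e2)) = lines (f1 + a' *: f2).
  have Ga := affine_point_inG hK hV n1 a.
  apply: (affine_point_surj hK' hV' k2 k1 (h1 _ Ga)); rewrite -eY => e.
  by apply: (affine_point_finite n1 (a := a)); rewrite -eX; apply: (compl_iso_inj iso Ga GX).
have [h hh] := choice ex; exists h; apply: inj_surj_bijective => [a a' e|a'].
  apply: (affine_point_inj hK hV n2 n1).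
  apply: (compl_iso_inj iso); try exact: affine_point_inG.
  by rewrite !hh e.
have Ga := affine_point_inG hK' hV' k1 a'.
have [|a ea] := affine_point_surj hK hV n2 n1 (h2 _ Ga).
  rewrite -eX => e; apply: (affine_point_finite k1 (a := a')).
  by rewrite -eY -e h4.
by exists a; apply: (affine_point_inj hK' hV' k2 k1); rewrite -hh -ea h4.
Qed.

(** Stated for additive bijections over unrelated rings, so that it serves both semilinear maps on
    [V] and maps out of the row space over [K^c]. *)
Lemma direct_sum_additive_image (R S : unitRingType) (U : lmodType R) (U' : lmodType S)
    (f : U -> U') (A B : U -> Prop) (A' B' : U' -> Prop) :
  bijective f -> (forall x y, f (x + y) = f x + f y) ->
  (forall y, A' y <-> exists x, A x /\ f x = y) ->
  (forall y, B' y <-> exists x, B x /\ f x = y) ->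
  (direct_sum A B <-> direct_sum A' B').
Proof.
move=> fb fD hA hB; have inj := bij_inj fb; have [g gK fK] := fb.
have f0 : f 0 = 0 by apply: (addrI (f 0)); rewrite -fD !addr0.
split=> -[d1 d2]; split.
- move=> _ /hA[x [Ax <-]] /hB[y [By /inj e]]; rewrite e in By.
  by rewrite (d1 x).
- move=> v; have [x [y [Ax By e]]] := d2 (g v).
  exists (f x), (f y); split; [by apply/hA; exists x|by apply/hB; exists y|].
  by rewrite -fD -e fK.
- move=> v Av Bv; apply: inj; rewrite f0; apply: d1.
    by apply/hA; exists v.
  by apply/hB; exists v.
move=> v; have [_ [_ [/hA[x [Ax <-]] /hB[y [By <-]] e]]] := d2 (f v).
by exists x, y; split=> //; apply: inj; rewrite fD.
Qed.

Lemma has_dim0_direct_sum (K : unitRingType) (V : lmodType K) (X Y : V -> Prop) :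
  has_dim V 0 -> X 0 -> Y 0 -> direct_sum X Y.
Proof.
move=> [f [_ [g gK _]]] X0 Y0; have all0 (v : V) : v = 0 by rewrite -[v]gK -[RHS]gK !thinmx0.
split=> [v _ _|v]; first exact: all0.
by exists 0, 0; split=> //; rewrite (all0 v) addr0.
Qed.

Theorem theorem4p2 (K K' : unitRingType) (hK : division_ring K) (hK' : division_ring K')
  (V : lmodType K) (V' : lmodType K') (m : nat) (hdim : has_dim V (2 * m)%N)
  (hG' : exists X : V' -> Prop, inG X)
  (phi : Gset V -> Gset V') (hphi : bijective phi) :
  distant_iso phi <->
  [\/ has_dim V 0 /\ has_dim V' 0,
      [/\ has_dim V 2, has_dim V' 2 & exists h : K -> K', bijective h]
    | [/\ (4 <= 2 * m)%N, has_dim V' (2 * m)%N &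
        (exists (s : K -> K') (f : V -> V'),
           [/\ ring_iso s, semilinear_bij s f &
               forall (X : Gset V) (y : V'),
                 sval (phi X) y <-> exists x, sval X x /\ f x = y])
        \/
        (exists (s : K -> K') (f : (V -> K) -> V'),
           [/\ ring_antiiso s, dual_semilinear_bij s f &
               forall (X : Gset V) (y : V'),
                 sval (phi X) y <->
                 exists p, [/\ functional p, (forall x, sval X x -> p x = 0) & f p = y]])]].
Proof.
have [psi c1 c2] := hphi; split=> [d|].
  have iso := distant_compl_iso c1 c2 d.
  have hV' := compl_iso_has_dim hK hK' iso hdim.
  have [m0|[m1|m2]] : m = 0%N \/ (m = 1%N \/ (2 <= m)%N) by lia.
  - by constructor 1; rewrite m0 in hdim hV'.
  - constructor 2; rewrite m1 in hdim hV'; split=> //.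
    exact: (plane_scalars hK hK' hdim hV' iso).
  constructor 3; split=> //; first by lia.
  have [[s [f [si sf fP]]]|[s [f [si sf fP]]]] := chow_dual hK hK' hdim hV' m2 iso.
    left; exists s, f; split=> // X y.
    by have := fP (gsub X) y (gsub_inG X); rewrite sub_ofE.
  right; exists s, f; split=> // X y.
  by have := fP (gsub X) y (gsub_inG X); rewrite sub_ofE.
have sub0G (L : unitRingType) (U : lmodType L) (X : Gset U) : sval X 0 by apply: (sub0 (gsub X)).
case=> [[h h']|[h h' _]|[m2 h' [[s [f [_ [fb fD _] fP]]]|[s [f [_ [f1 f2 f3 _] fP]]]]]] X Y.
- by split=> _; apply: has_dim0_direct_sum.
- have e1 := plane_direct_sum hK h (gsub_inG X) (gsub_inG Y).
  have e2 := plane_direct_sum hK' h' (gsub_inG (phi X)) (gsub_inG (phi Y)).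
  split=> [/e1 n|/e2 n]; [apply/e2 => e; apply: n|apply/e1 => e; apply: n].
    by congr gsub; apply: (can_inj c1); apply: gsub_inj.
  by congr (gsub (phi _)); apply: gsub_inj.
- exact: (direct_sum_additive_image fb fD (fP X) (fP Y)).
have [b hb] := row_pairing hdim.
have hW : has_dim 'rV[K^c]_(2 * m) (2 * m)%N by exists id; split=> //; exists id.
have [hp bD _ br _] := hb.
have e1 := direct_sum_perpE hK hb hdim hW (gsub_inG X) (gsub_inG Y).
(* Through the pairing the annihilator becomes [perp] in the row space, so this case reduces to an
   additive bijection out of that space. *)
have eP (Z : Gset V) y : sval (phi Z) y <-> exists w, perp hb (gsub Z) w /\ f (b^~ w) = y.
  split=> [/fP[p [fp p0 <-]]|[w [hw <-]]].
    have [w hw] := br p fp; have -> : p = b^~ w by apply: funext.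
    by exists w; split=> // x Zx; rewrite -hw p0.
  by apply/fP; exists (b^~ w).
have fb : bijective (fun w => f (b^~ w)).
  apply: inj_surj_bijective => [w w' /(f1 _ _ (hp w) (hp w')) e|y].
    by apply: (pairing_ext hb) => v; apply: (congr1 (fun p => p v) e).
  have [p [fp <-]] := f2 y; have [w hw] := br p fp.
  by exists w; congr f; apply: funext => v; rewrite hw.
apply: (iff_trans e1); apply: (direct_sum_additive_image fb _ (eP X) (eP Y)) => w w'.
by rewrite -(f3 _ _ (hp w) (hp w')); congr f; apply: funext => v; rewrite bD.
Qed.
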